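(* Let $m\ge 5$ be an integer and let $G\in\mathscr{U}_{2m,m}\setminus\{U_{2m,m}\}$, i.e. $G$ is a unicyclic graph on $2m$ vertices with matching number $m$ that is not isomorphic to $U_{2m,m}$. Then $\xi^d(G)\ge 43m^2-72m-4$, with equality if and only if $G\cong U_{2m,m}'$.
   Context: All graphs are finite, simple and connected. For a graph $G$ and $v\in V_G$, $d(u,v)$ is the usual graph distance, $\varepsilon_G(v)=\max_{u\in V_G} d(u,v)$ is the eccentricity, and $D_G(v)=\sum_{u\in V_G} d(u,v)$. The eccentric distance sum is $\xi^d(G)=\sum_{v\in V_G}\varepsilon_G(v)D_G(v)$. A unicyclic graph is a connected graph with $|V_G|=|E_G|$. The matching number is the maximum number of pairwise independent edges. $\mathscr{U}_{n,m}$ is the set of unicyclic graphs with $n$ vertices and matching number $m$. $U_{n,m}$ is the $n$-vertex graph obtained from a triangle $C_3=u_1u_2u_3u_1$ by attaching $n-2m+1$ pendant vertices and $m-2$ pendant paths of length $2$ (each by identifying one of its end vertices with $u_1$) to the single vertex $u_1$. $U_{n,m}'$ (for $m\ge 3$) is the $n$-vertex graph obtained from a cycle $C_5=u_1u_2u_3u_4u_5u_1$ by attaching $n-2m+1$ pendant vertices and $m-3$ pendant paths of length $2$ (each by identifying one of its end vertices with $u_2$) to the single vertex $u_2$. *)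

(* Defs.v *)
From HB Require Import structures.
From mathcomp Require Import all_boot all_order all_algebra.
Set Implicit Arguments.
Unset Strict Implicit.
Unset Printing Implicit Defensive.

Section Graph.
Variables (T : finType) (e : rel T).

Definition simple_graph : Prop := symmetric e /\ irreflexive e.

Definition connected_graph : Prop := forall x y : T, connect e x y.

Definition walk_of_length (u v : T) (k : nat) : bool :=
  [exists p : k.-tuple T, path e u p && (last u p == v)].

(* A shortest walk has fewer than #|T| edges, so the search below finds it;
   the value is #|T| when v is not reachable from u. *)
Definition dist (u v : T) : nat := find (walk_of_length u v) (iota 0 #|T|).

Definition ecc (v : T) : nat := \max_(u : T) dist u v.

Definition distsum (v : T) : nat := \sum_(u : T) dist u v.

Definition ecc_dist_sum : nat := \sum_(v : T) ecc v * distsum v.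

Definition edges : {set {set T}} := [set [set x; y] | x in T, y in T & e x y].

Definition unicyclic : Prop :=
  [/\ simple_graph, connected_graph & #|T| = #|edges|].

Definition matching (M : {set {set T}}) : bool :=
  (M \subset edges) && trivIset M.

Definition matching_number : nat :=
  \max_(M : {set {set T}} | matching M) #|M|.

Definition unicyclic_class (n m : nat) : Prop :=
  [/\ unicyclic, #|T| = n & matching_number = m].

End Graph.

Definition isomorphic (T T' : finType) (e : rel T) (e' : rel T') : Prop :=
  exists2 f : T -> T', bijective f & forall x y, e' (f x) (f y) = e x y.

(* Cycle vertices, p pendant vertices, and q pendant paths of length 2, whose
   two new vertices are (i, false), next to the cycle, and (i, true), a leaf. *)
Definition loaded_cycle_vertex (k p q : nat) : finType :=
  ('I_k + 'I_p + 'I_q * bool)%type.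

(* Each edge is listed in one direction; c is the loaded vertex of the cycle. *)
Definition loaded_cycle_arc (k p q : nat) (c : 'I_k)
    (x y : loaded_cycle_vertex k p q) : bool :=
  match x, y with
  | inl (inl i), inl (inl j) => j == ordS i
  | inl (inl i), inl (inr _) => i == c
  | inl (inl i), inr (_, b) => (i == c) && ~~ b
  | inr (s, b), inr (t, b') => [&& s == t, ~~ b & b']
  | _, _ => false
  end.

Definition loaded_cycle (k p q : nat) (c : 'I_k) :
    rel (loaded_cycle_vertex k p q) :=
  [rel x y | loaded_cycle_arc c x y || loaded_cycle_arc c y x].

(* The vertex u_i of the cycle is the ordinal i - 1.  The number of pendant
   vertices, n - 2m + 1, is written n + 1 - 2m since subtraction truncates. *)
Definition U_graph (n m : nat) :
    rel (loaded_cycle_vertex 3 (n + 1 - 2 * m) (m - 2)) :=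
  loaded_cycle (inord 0).
Arguments U_graph n m : clear implicits.

Definition U'_graph (n m : nat) :
    rel (loaded_cycle_vertex 5 (n + 1 - 2 * m) (m - 3)) :=
  loaded_cycle (inord 1).
Arguments U'_graph n m : clear implicits.

(* Main.v *)
(** The graph has a perfect matching mu, and the edges number 2m, so exactly m
    edges lie outside mu.

    If some vertex c has eccentricity at most 2, let d be its degree.  A vertex
    z <> c such that neither z nor mu z is adjacent to c needs an edge outside
    mu joining it to a neighbour of c, and only m - d + 1 edges outside mu avoid
    c.  Counting gives d >= m - 1 and leaves ten graphs: a core of at most 8
    vertices with pendant paths of length 2 attached at c.  Their eccentric
    distance sums are explicit quadratic polynomials in m; U is the only one
    below 43 m^2 - 72 m - 4 and U' the only one equal to it.

    If all eccentricities are at least 3, the bound is strict.  Bounding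
    distances by degrees gives a total distance sum of at least
    12 m^2 - 18 m - L (m - 1), where L is the number of leaves, and all
    eccentricities are at least 4 outside the set S of vertices of eccentricity
    3, even at least 5 at the leaves not attached to S.  This suffices when
    |S| <= 3.  A pendant path of length 2 attached at h forces S into h and its
    neighbours, of which at most two lie in S.  Without such a path every
    non-leaf has exactly two non-leaf neighbours, hence 2m <= 12 or S is empty,
    and counting the levels around the elements of S settles m = 5 and m = 6. *)

Require Import Defs.
From mathcomp Require Import all_boot all_order all_algebra.
From mathcomp Require Import zify.
Set Implicit Arguments.
Unset Strict Implicit.
Unset Printing Implicit Defensive.

(** * Distances, degrees and perfect matchings *)

Section Walks.
Variables (T : finType) (e : rel T).

Lemma walk_of_lengthP (u v : T) (k : nat) :
  reflect (exists p, [/\ size p = k, path e u p & last u p = v])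
          (walk_of_length e u v k).
Proof.
apply: (iffP existsP) => [[p /andP[ep /eqP lp]]|[p [sp ep lp]]].
  by exists p; rewrite size_tuple.
have sp' : size p == k by apply/eqP.
by exists (Tuple sp') => /=; rewrite ep lp eqxx.
Qed.

Lemma dist_le_size (u : T) (p : seq T) :
  path e u p -> dist e u (last u p) <= size p.
Proof.
move=> ep; rewrite /dist; set a := walk_of_length e u _.
have := find_size a (iota 0 #|T|); rewrite size_iota => le_n.
(* The search value never exceeds [#|T|], which settles long walks; a shorter walk lies in the
   searched range. *)
case: (leqP #|T| (size p)) => [/(leq_trans le_n)//|lt_n].
rewrite leqNgt; apply/negP => /(before_find 0); rewrite nth_iota // add0n.
by move/walk_of_lengthP; apply; exists p.
Qed.

(** Removing repetitions leaves a walk with fewer than [#|T|] edges, so the search succeeds before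
    its default value. *)
Lemma connect_dist (u v : T) : connect e u v ->
  exists p, [/\ size p = dist e u v, path e u p & last u p = v].
Proof.
case/connectP=> p ep ->; case/shortenP: ep => q eq_ uq _.
have lt_n : size q < #|T| by have := max_card (mem (u :: q)); rewrite (card_uniqP uq).
apply/walk_of_lengthP.
have hasw : has (walk_of_length e u (last u q)) (iota 0 #|T|).
  apply/hasP; exists (size q); first by rewrite mem_iota.
  by apply/walk_of_lengthP; exists q.
have := nth_find 0 hasw; rewrite nth_iota ?add0n //.
by rewrite -[X in _ < X](size_iota 0) -has_find.
Qed.

Lemma distxx (u : T) : dist e u u = 0.
Proof. by apply/eqP; rewrite -leqn0; apply: (@dist_le_size u [::]). Qed.

End Walks.

Definition deg (T : finType) (e : rel T) (v : T) : nat := #|[set u | e v u]|.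

Lemma cardE_sum (T : finType) (A : {set T}) : #|A| = \sum_v (v \in A).
Proof. by rewrite -sum1_card big_mkcond; apply: eq_bigr => v _; case: (v \in A). Qed.

Lemma degE (T : finType) (e : rel T) (v : T) : deg e v = \sum_u e v u.
Proof. by rewrite /deg cardE_sum; apply: eq_bigr => u _; rewrite inE. Qed.

Section ConnectedGraph.
Variables (T : finType) (e : rel T).
Hypotheses (e_sym : symmetric e) (e_irr : irreflexive e).
Hypothesis e_conn : connected_graph e.
Local Notation d := (dist e).
Local Notation deg := (deg e).

Lemma dist_walk (u v : T) :
  exists p, [/\ size p = d u v, path e u p & last u p = v].
Proof. exact: connect_dist. Qed.

Lemma dist_triangle (u v w : T) : d u w <= d u v + d v w.
Proof.
have [p [<- ep lp]] := dist_walk u v; have [q [<- eq_ lq]] := dist_walk v w.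
rewrite -size_cat -lq -lp -last_cat; apply: dist_le_size.
by rewrite cat_path ep lp.
Qed.

Lemma dist_eq0 (u v : T) : (d u v == 0) = (u == v).
Proof.
apply/idP/eqP => [/eqP d0|->]; last by rewrite distxx.
by have [[|x p] [s ep <-]] := dist_walk u v; rewrite d0 in s.
Qed.

Lemma dist_gt0 (u v : T) : (0 < d u v) = (u != v).
Proof. by rewrite lt0n dist_eq0. Qed.

Lemma dist_sym (u v : T) : d u v = d v u.
Proof.
wlog: u v / d v u <= d u v => [IH|le_vu].
  by case/orP: (leq_total (d u v) (d v u)) => /IH.
apply/eqP; rewrite eqn_leq le_vu andbT.
have [p [<- ep lp]] := dist_walk v u.
have := @dist_le_size _ e u (rev (belast v p)); rewrite size_rev size_belast.
have -> : last u (rev (belast v p)) = v.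
  by case: p lp {ep} => [|x p] /= lp; rewrite ?rev_cons ?last_rcons.
by apply; rewrite -lp rev_path (eq_path (e' := e)).
Qed.

Lemma dist_edge_le (u x y : T) : e x y -> d u y <= (d u x).+1.
Proof.
move=> exy; rewrite -addn1; apply: leq_trans (dist_triangle u x y) _.
by rewrite leq_add2l (@dist_le_size _ e x [:: y]) //= exy.
Qed.

Lemma dist_eq1 (u v : T) : (d u v == 1) = e u v.
Proof.
apply/eqP/idP => [d1|euv].
  have [[|x [|y p]] [s /= ep lp]] := dist_walk u v; rewrite d1 // in s.
  by move: ep; rewrite lp andbT.
apply/eqP; rewrite eqn_leq dist_gt0; apply/andP; split.
  by have := dist_edge_le u euv; rewrite distxx.
by apply: contraTneq euv => ->; rewrite e_irr.
Qed.

Lemma dist_pred (u v : T) (k : nat) : d u v = k.+1 ->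
  exists2 w, d u w = k & e w v.
Proof.
move=> dk; have [p [sp ep lp]] := dist_walk u v.
case/lastP: p sp ep lp => [|p x] sp ep lp; first by rewrite dk in sp.
rewrite last_rcons in lp; subst x.
move: ep; rewrite rcons_path size_rcons dk in sp * => /andP[ep ev].
exists (last u p) => //; apply/eqP; case: sp => sp.
rewrite eqn_leq -{1}sp dist_le_size //= -ltnS -dk; exact: dist_edge_le.
Qed.

(** Along a shortest walk every edge accounts for at most 1 of [phi v]. This is the tool for lower
    bounds on distances. *)
Lemma lipschitz_le_dist (phi : T -> nat) (u v : T) :
  phi u = 0 -> (forall x y, e x y -> phi y <= (phi x).+1) -> phi v <= d u v.
Proof.
move=> phi0 lip; have [k] := ubnP (d u v); elim: k v => // k IH v.
case E : (d u v) => [|j] ltj.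
  by move/eqP: E; rewrite dist_eq0 => /eqP <-; rewrite phi0.
have [w dw /lip lew] := dist_pred E; apply: leq_trans lew _.
by rewrite ltnS -dw IH // dw.
Qed.

Lemma dist_ge2 (u v : T) : u != v -> ~~ e u v -> 2 <= d u v.
Proof.
rewrite -dist_gt0 -dist_eq1; lia.
Qed.

Lemma dist_ge3 (u v : T) : u != v -> ~~ e u v ->
  (forall x, e u x -> ~~ e x v) -> 3 <= d u v.
Proof.
move=> uv nuv nx; have := dist_ge2 uv nuv; rewrite leq_eqVlt => /predU1P[E|//].
have [w /eqP] := dist_pred (esym E).
by rewrite dist_eq1 => /nx /negP.
Qed.

Lemma dist_le_ecc (u v : T) : d u v <= ecc e v.
Proof. exact: (leq_bigmax (F := fun u => d u v)). Qed.

Lemma ecc_attained (v : T) : exists u, d u v = ecc e v.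
Proof.
have c : 0 < #|T| by apply/card_gt0P; exists v.
by have [u E] := eq_bigmax (fun u => d u v) c; exists u; rewrite /ecc E.
Qed.

Lemma distsum_sym (v : T) : distsum e v = \sum_u d v u.
Proof. by apply: eq_bigr => u _; rewrite dist_sym. Qed.

End ConnectedGraph.

(** * Degree sums and edge counts *)

Section DegreeSum.
Variables (T : finType) (e : rel T).
Hypotheses (e_sym : symmetric e) (e_irr : irreflexive e).

Lemma card_arcs : #|[set a : T * T | e a.1 a.2]| = \sum_v deg e v.
Proof.
rewrite -sum1_card (eq_bigl (fun a : T * T => true && e a.1 a.2)); last first.
  by move=> a; rewrite inE.
rewrite -(pair_big_dep xpredT e (fun _ _ => 1)) /=.
by apply: eq_bigr => v _; rewrite /deg -sum1_card; apply: eq_bigl => u; rewrite inE.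
Qed.

(** Double counting of incidences: [u] to [[set v; u]] maps the neighbours of [v] bijectively to the
    edges containing [v], and every edge has two ends. *)
Lemma sum_deg : \sum_v deg e v = 2 * #|edges e|.
Proof.
have cardE E : E \in edges e -> #|E| = 2.
  case/imset2P => x y _; rewrite inE => /andP[_ exy] ->.
  by rewrite cards2; case: eqP exy => // ->; rewrite e_irr.
have degE v : deg e v = \sum_(E in edges e) (v \in E).
  have -> : \sum_(E in edges e) (v \in E) = #|[set E in edges e | v \in E]|.
    by rewrite -sum1dep_card big_mkcondr; apply: eq_bigr => E _; case: (v \in E).
  rewrite /deg -(card_in_imset (f := fun u => [set v; u])).
    apply: eq_card => E; rewrite inE; apply/imsetP/andP.
      case=> u; rewrite inE => evu ->; split; last by rewrite !inE eqxx.
      by apply/imset2P; exists v u => //; rewrite inE.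
    case=> /imset2P[x y _]; rewrite inE => /andP[_ exy] ->.
    rewrite !inE => /orP[/eqP->|/eqP->]; first by exists y; rewrite ?inE.
    by exists x; rewrite ?inE 1?e_sym // setUC.
  move=> x y; rewrite !inE => evx evy E.
  have : x \in [set v; y] by rewrite -E !inE eqxx orbT.
  rewrite !inE => /orP[/eqP xv|/eqP//].
  by rewrite xv e_irr in evx.
rewrite (eq_bigr _ (fun v _ => degE v)) exchange_big /=.
transitivity (\sum_(E in edges e) 2); last by rewrite sum_nat_const mulnC.
apply: eq_bigr => E /cardE <-.
by rewrite -sum1_card [RHS]big_mkcond; apply: eq_bigr => v _; case: (v \in E).
Qed.

(** A breadth-first tree rooted at [r] has an edge from each other vertex to its parent, which
    supplies two arcs. *)
Lemma connected_sum_deg : connected_graph e -> 2 * #|T| <= (\sum_v deg e v) + 2.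
Proof.
move=> e_conn; have [->//|] := posnP #|T|; case/card_gt0P => r _.
pose D := dist e r.
pose par v := odflt r [pick w | (D v == (D w).+1) && e w v].
have parP v : v != r -> (D v = (D (par v)).+1) /\ e (par v) v.
  move=> vr; rewrite /par; case: pickP => [w /andP[/eqP-> ->//]|none].
  have : 0 < D v by rewrite (dist_gt0 e_conn) eq_sym.
  case E : (D v) => [//|k] _; have [w dw ew] := dist_pred e_conn E.
  by have := none w; rewrite E /D dw eqxx ew.
pose up := [set (v, par v) | v in [set~ r]].
pose down := [set (par v, v) | v in [set~ r]].
have cu : #|up| = #|T|.-1 by rewrite card_imset ?cardsC1 // => x y [].
have cd : #|down| = #|T|.-1 by rewrite card_imset ?cardsC1 // => x y [].
(* Arcs of [up] decrease the distance to [r], those of [down] increase it. *)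
have dis : [disjoint up & down].
  apply/pred0P => a /=; apply/negP => /andP[/imsetP[x xr ->] /imsetP[y yr [E1 E2]]].
  move: xr yr; rewrite !inE => /parP[Dx _] /parP[Dy _].
  by move: Dx Dy; rewrite -E1 E2; lia.
have : up :|: down \subset [set a | e a.1 a.2].
  apply/subsetP => a; rewrite !inE => /orP[] /imsetP[x xr ->] /=.
    by rewrite e_sym; move: xr; rewrite !inE => /parP[].
  by move: xr; rewrite !inE => /parP[].
move/subset_leq_card; rewrite cardsU disjoint_setI0 // cards0 cu cd card_arcs.
lia.
Qed.

End DegreeSum.

(** * The perfect matching as an involution *)

Section PerfectMatching.
Variables (T : finType) (e : rel T) (m : nat).
Hypotheses (e_sym : symmetric e) (e_irr : irreflexive e).
Hypotheses (card_T : #|T| = 2 * m) (mn : matching_number e = m).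

(** A maximum matching consists of [m] disjoint edges and hence covers all [2 * m] vertices; [mu]
    exchanges the ends of each of them. *)
Lemma perfect_matching : exists mu : T -> T,
  involutive mu /\ (forall v, e v (mu v)).
Proof.
have M0 : matching e set0.
  by rewrite /matching sub0set; apply/trivIsetP => A B; rewrite inE.
have : 0 < #|[set M | matching e M]| by apply/card_gt0P; exists set0; rewrite inE.
move/(eq_bigmax_cond (fun M : {set {set T}} => #|M|)) => [M].
rewrite inE => /andP[Me triv] EM.
have {}EM : #|M| = m.
  by rewrite -EM -mn; apply: eq_bigl => A; rewrite inE.
have cardE E : E \in M -> #|E| = 2.
  move/(subsetP Me) => /imset2P[x y _]; rewrite inE => /andP[_ exy] ->.
  by rewrite cards2; case: eqP exy => // ->; rewrite e_irr.
have cov v : v \in cover M.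
  suff -> : cover M = setT by rewrite inE.
  apply/eqP; rewrite eqEcard subsetT cardsT card_T -(eqP triv).
  by rewrite (eq_bigr _ cardE) sum_nat_const EM leq_eqVlt mulnC eqxx.
have ex v : exists w, [set v; w] \in M /\ e v w.
  have := cov v; rewrite -mem_pblock => vB.
  have := pblock_mem (cov v) => BM; move/(subsetP Me): (BM) => /imset2P[x y _].
  rewrite inE => /andP[_ exy] E; rewrite E !inE in vB.
  case/orP: vB => /eqP->; first by exists y; rewrite -E.
  by exists x; rewrite e_sym setUC -E.
pose mu v := odflt v [pick w | ([set v; w] \in M) && e v w].
have muP v : [set v; mu v] \in M /\ e v (mu v).
  rewrite /mu; case: pickP => [w /andP[]//|none].
  by have [w [wM ew]] := ex v; have := none w; rewrite wM ew.
exists mu; split=> [v|v]; last by have [] := muP v.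
have [A1 e1] := muP v; have [A2 e2] := muP (mu v).
have E : [set mu v; mu (mu v)] = [set v; mu v].
  apply/eqP; apply: contraT => ne.
  have /pred0P/(_ (mu v)) := trivIsetP triv _ _ A2 A1 ne.
  by rewrite /= !inE eqxx orbT.
have : mu (mu v) \in [set v; mu v] by rewrite -E !inE eqxx orbT.
by rewrite !inE => /orP[/eqP//|/eqP E']; rewrite E' e_irr in e2.
Qed.

End PerfectMatching.

(** * Small graphs loaded with pendant paths of length 2 *)

Lemma card_neq (T : finType) (z : T) : #|[pred i | i != z]| = #|T|.-1.
Proof. exact: cardC1. Qed.

Lemma card_neq2 (T : finType) (z w : T) : w != z ->
  #|[pred i | (i != z) && (i != w)]| + 2 = #|T|.
Proof.
move=> wz; rewrite -(cardsC [set z; w]) cards2 eq_sym wz addnC; congr (_ + _).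
by apply: eq_card => u; rewrite !inE negb_or.
Qed.

Section Pendant.
Variables (T : finType) (e : rel T).
Hypotheses (e_sym : symmetric e) (e_irr : irreflexive e).
Hypothesis e_conn : connected_graph e.
Local Notation d := (dist e).

Lemma dist_leaf (z w u : T) :
  (forall x, e z x -> x = w) -> u != z -> d u z = (d u w).+1.
Proof.
move=> zw; rewrite -(dist_gt0 e_conn); case E : (d u z) => [//|k] _.
by have [x <-] := dist_pred e_conn E; rewrite e_sym => /zw ->.
Qed.

(** A shortest walk from [u] to [w] cannot arrive from the leaf [z], which is farther from [u] than
    [w]; it arrives from [g]. *)
Lemma dist_pendant_path (z w g u : T) :
  (forall x, e z x -> x = w) -> (forall x, e w x -> x = z \/ x = g) ->
  u != w -> u != z -> d u w = (d u g).+1.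
Proof.
move=> zw wg uw uz; have := dist_leaf zw uz; move: uw.
rewrite -(dist_gt0 e_conn); case E : (d u w) => [//|k] _.
have [x dx] := dist_pred e_conn E; rewrite e_sym => /wg[] Ex; subst x; last by rewrite dx.
by rewrite dx; lia.
Qed.

(** Passing from [w] to [z] adds 1 to the distance from every vertex other than [z], while [z]
    itself goes from distance 1 to 0. *)
Lemma distsum_leaf (z w : T) : z != w ->
  (forall x, e z x -> x = w) -> e z w -> distsum e z + 2 = distsum e w + #|T|.
Proof.
move=> zw nz ezw; rewrite /distsum.
rewrite (bigD1 z) //= distxx [in RHS](bigD1 z) //=.
have -> : d z w = 1 by apply/eqP; rewrite dist_eq1.
rewrite (eq_bigr (fun u => d u w + 1)); last by move=> u; rewrite addn1; exact: dist_leaf.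
rewrite big_split /= sum1_card card_neq.
have : 0 < #|T| by apply/card_gt0P; exists z.
rewrite /=; lia.
Qed.

(** Passing from [g] to [w] adds 1 to the distance from the [#|T| - 2] vertices off the path and
    subtracts 1 for each of [z] and [w]. *)
Lemma distsum_pendant_path (z w g : T) : w != z -> g != z ->
  (forall x, e z x -> x = w) -> (forall x, e w x -> x = z \/ x = g) -> e z w -> e w g ->
  distsum e w + 4 = distsum e g + #|T|.
Proof.
move=> wz gz nz nw ezw ewg; rewrite /distsum.
have gw : g != w by apply: contraTneq ewg => ->; rewrite e_irr.
rewrite (bigD1 z) //= (bigD1 w) //= distxx [in RHS](bigD1 z) //= [in RHS](bigD1 w) //=.
have d1 x y : e x y -> d x y = 1 by move=> exy; apply/eqP; rewrite dist_eq1.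
rewrite (d1 z w) // (d1 w g) //.
have -> : d z g = 2.
  by rewrite (dist_sym e_sym e_conn) (dist_leaf nz) // (d1 g w) // e_sym.
rewrite (eq_bigr (fun u => d u g + 1)); last first.
  by move=> u /andP[uz uw]; rewrite addn1; exact: (dist_pendant_path nz nw).
rewrite big_split /= sum1_card.
have -> : #|[pred i | (i != z) && (i != w)]| = #|T| - 2.
  by rewrite -(card_neq2 wz) addnK.
have := card_neq2 wz; rewrite /=; lia.
Qed.

End Pendant.

(** * Cores given by distance matrices *)

Definition mx_entry (M : seq (seq nat)) (i j : nat) : nat := nth 0 (nth [::] M i) j.

Definition bounded_all (k : nat) (P : nat -> bool) : bool := all P (iota 0 k).

Lemma bounded_allP (k : nat) (P : nat -> bool) :
  reflect (forall i, i < k -> P i) (bounded_all k P).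
Proof.
apply: (iffP allP) => H i; first by move=> ik; apply: H; rewrite mem_iota.
by rewrite mem_iota => ik; apply: H.
Qed.

(* M is the distance matrix of a graph on 0, ..., size M - 1 that is rooted at
   0 and has depth exactly 2; its edges are the entries equal to 1. *)
Definition dist_matrix (M : seq (seq nat)) : bool :=
  let k := size M in let m := mx_entry M in
  [&& 3 < k,
      bounded_all k (fun i => m i i == 0),
      bounded_all k (fun i => bounded_all k (fun j => (m i j == m j i))),
      bounded_all k (fun i => bounded_all k (fun j => bounded_all k (fun l =>
        (m j l == 1) ==> (m i l <= (m i j).+1)))),
      bounded_all k (fun i => bounded_all k (fun j => (i != j) ==>
        has (fun l => (m l j == 1) && (m i j == (m i l).+1)) (iota 0 k))),
      bounded_all k (fun j => m 0 j <= 2) &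
      has (fun j => m 0 j == 2) (iota 0 k)].

(* The graph e consists of a small graph on c :: s, whose distance matrix is M,
   and of pendant paths of length 2 attached at c. *)
Definition loaded_by (T : finType) (e : rel T) (M : seq (seq nat))
    (c : T) (s : seq T) (mu : T -> T) : Prop :=
  [/\ uniq (c :: s), size (c :: s) = size M,
      forall i j, i < size M -> j < size M ->
        e (nth c (c :: s) i) (nth c (c :: s) j) = (mx_entry M i j == 1) &
      forall v, v \notin c :: s ->
        [/\ mu v \notin c :: s, mu (mu v) = v, e c (mu v) = ~~ e c v &
            forall u, e v u = (u == mu v) || (u == c) && e c v]].

Definition mx_sum (M : seq (seq nat)) (f : nat -> nat) : nat :=
  sumn [seq f i | i <- iota 0 (size M)].

Lemma mx_sumE M f : mx_sum M f = \sum_(i < size M) f i.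
Proof. by rewrite /mx_sum sumnE big_map -[in LHS](subn0 (size M)) big_mkord. Qed.

Section Loaded.
Variables (T : finType) (e : rel T) (M : seq (seq nat)).
Variables (c : T) (s : seq T) (mu : T -> T).
Hypotheses (e_sym : symmetric e) (e_irr : irreflexive e).
Hypothesis e_conn : connected_graph e.
Hypotheses (Mok : dist_matrix M) (L : loaded_by e M c s mu).
Local Notation d := (dist e).
Local Notation k := (size M).
Local Notation m := (mx_entry M).
Local Notation X := (c :: s).
Local Notation x_ := (nth c X).

Let uX : uniq X. Proof. by case: L. Qed.
Let sX : size X = k. Proof. by case: L. Qed.
Let k_gt0 : 0 < k. Proof. by rewrite -sX. Qed.

Let eX i j : i < k -> j < k -> e (x_ i) (x_ j) = (m i j == 1).
Proof. by case: L => _ _ H _; exact: H. Qed.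

Let xin i : i < k -> x_ i \in X. Proof. by move=> ik; rewrite mem_nth ?sX. Qed.

Let idx v : v \in X -> index v X < k. Proof. by rewrite -sX index_mem. Qed.

Let off v : v \notin X -> [/\ mu v \notin X, mu (mu v) = v, e c (mu v) = ~~ e c v &
            forall u, e v u = (u == mu v) || (u == c) && e c v].
Proof. by case: L => _ _ _; exact. Qed.

(** The predecessor condition on [M] yields walks, hence the upper bound; a Lipschitz extension of
    row [i] to the pendant paths yields the lower one. *)
Lemma loaded_dist_core i j : i < k -> j < k -> d (x_ i) (x_ j) = m i j.
Proof.
case/and5P: Mok => _ /bounded_allP m0 /bounded_allP msym /bounded_allP mlip
  /and3P[/bounded_allP mstep _ _] ik jk.
have cX : c \in X by rewrite mem_head.
apply/eqP; rewrite eqn_leq; apply/andP; split.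
  have [n] := ubnP (m i j); elim: n j jk => // n IH j jk ltn.
  case: (eqVneq i j) => [<-|ij]; first by rewrite distxx.
  have /bounded_allP/(_ _ jk)/implyP/(_ ij)/hasP[l] := mstep _ ik.
  rewrite mem_iota /= add0n => lk /andP[ml /eqP E].
  rewrite E; apply: leq_trans (_ : (d (x_ i) (x_ l)).+1 <= _).
    by apply: dist_edge_le => //; rewrite eX.
  by rewrite ltnS IH //; move: ltn; rewrite E.
(* Off the core the walk must pass the root: 1 more for a middle vertex, 2 more for a tip. *)
pose phi v := if v \in X then m i (index v X)
              else m i 0 + (if e c v then 1 else 2).
have -> : m i j = phi (x_ j) by rewrite /phi xin // index_uniq ?sX.
apply: lipschitz_le_dist => // [|x y].
  by rewrite /phi xin // index_uniq ?sX //; apply/eqP/m0.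
rewrite /phi; case: (boolP (x \in X)) => [xX|xX].
  case: (boolP (y \in X)) => [yX|yX].
    move=> exy; have /bounded_allP/(_ _ (idx xX))/bounded_allP/(_ _ (idx yX)) := mlip _ ik.
    by move/implyP; apply; rewrite -eX ?idx // !nth_index.
  have [muy _ _ ny] := off yX; rewrite e_sym ny => /orP[/eqP xy|/andP[/eqP-> ecy]].
    by rewrite xy (negPf muy) in xX.
  by rewrite ecy /= eqxx; lia.
have [mux mumu cmu nx] := off xX.
rewrite nx => /orP[/eqP->|/andP[/eqP-> ->]]; last by rewrite cX /= eqxx; lia.
by rewrite (negPf mux) cmu; case: (e c x) => /=; lia.
Qed.

(** The middle vertices of the pendant paths; [mu] sends each to its tip. *)
Let W := [set v | (v \notin X) && e c v].

Let WP v : v \in W -> [/\ v \notin X, mu v \notin X, e c v, e c (mu v) = false & mu (mu v) = v].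
Proof. by rewrite in_set => /andP[vX ev]; have [? ? -> ?] := off vX; rewrite ev. Qed.

Let tipW v x : v \in W -> e (mu v) x -> x = v.
Proof.
move=> /WP[vX muX _ ecm mumu]; have [_ _ _ ->] := off muX.
by rewrite mumu ecm andbF orbF => /eqP.
Qed.

Let midW v x : v \in W -> e v x -> x = mu v \/ x = c.
Proof.
move=> /WP[vX _ _ _ _]; have [_ _ _ ->] := off vX.
by case/orP => [/eqP|/andP[/eqP]]; [left|right].
Qed.

Let e_mu v : v \in W -> e v (mu v).
Proof. by move=> /WP[vX _ _ _ _]; have [_ _ _ ->] := off vX; rewrite eqxx. Qed.

Lemma sum_off_core (F : T -> nat) :
  \sum_(v | v \notin X) F v = \sum_(v in W) (F v + F (mu v)).
Proof.
rewrite (bigID (fun v => e c v)) /= big_split /=; congr (_ + _).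
  by apply: eq_bigl => v; rewrite in_set.
rewrite (reindex_onto mu mu) => [|v /andP[vX _]]; last by have [] := off vX.
apply: eq_bigl => v; rewrite [RHS]in_set; apply/idP/idP.
  case/andP => /andP[mX ecm] /eqP mumu; have [] := off mX; rewrite mumu => -> _ -> _.
  by rewrite ecm.
by case/andP => vX ev; have [-> -> -> _] := off vX; rewrite ev eqxx.
Qed.

Lemma sum_core (F : T -> nat) : \sum_(v | v \in X) F v = \sum_(i < k) F (x_ i).
Proof.
by rewrite -(big_uniq _ uX) (big_nth c) big_mkord sX.
Qed.

Lemma sum_loaded (F : T -> nat) :
  \sum_v F v = \sum_(i < k) F (x_ i) + \sum_(v in W) (F v + F (mu v)).
Proof. by rewrite (bigID (mem X)) /= sum_core sum_off_core. Qed.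

Lemma card_loaded : #|T| = k + 2 * #|W|.
Proof.
have := sum_loaded (fun=> 1); rewrite !sum_nat_const card_ord /=.
by rewrite -[#|T|](_ : #|xpredT : pred T| = _) // !muln1 [_ * (1 + 1)]mulnC.
Qed.

Let dist_tip u v : v \in W -> u != v -> u != mu v -> d u (mu v) = (d u c).+2.
Proof.
move=> vW uv uz; rewrite (dist_leaf e_sym e_conn (@tipW v ^~ vW)) //.
by rewrite (dist_pendant_path e_sym e_conn (@tipW v ^~ vW) (@midW v ^~ vW)).
Qed.

Let dist_mid u v : v \in W -> u != v -> u != mu v -> d u v = (d u c).+1.
Proof.
move=> vW uv uz.
by rewrite (dist_pendant_path e_sym e_conn (@tipW v ^~ vW) (@midW v ^~ vW)).
Qed.

Let W_neq i v : i < k -> v \in W -> x_ i != v /\ x_ i != mu v.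
Proof.
move=> ik /WP[vX mX _ _ _]; split; [apply: contraNneq vX => <-|apply: contraNneq mX => <-];
exact: xin.
Qed.

Let lam i : i < k -> d (x_ i) c = m i 0.
Proof. by move=> ik; exact: (loaded_dist_core ik k_gt0). Qed.

Let lam2 i : i < k -> m i 0 <= 2.
Proof.
case/and5P: Mok => _ _ /bounded_allP msym _ /and3P[_ /bounded_allP m2 _] ik.
by have /bounded_allP/(_ 0 k_gt0)/eqP-> := msym _ ik; exact: m2.
Qed.

Let dist_c v : d v c <= 2.
Proof.
case: (boolP (v \in X)) => [vX|vX].
  by rewrite -(nth_index c vX) lam ?lam2 // idx.
case: (boolP (e c v)) => [ev|ev].
  by rewrite -(dist_eq1 e_irr e_conn) (dist_sym e_sym e_conn) in ev; rewrite (eqP ev).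
have [mX _ cm nv] := off vX.
have := @dist_triangle _ _ e_conn v (mu v) c.
have -> : d v (mu v) = 1 by apply/eqP; rewrite dist_eq1 // nv eqxx.
suff -> : d (mu v) c = 1 by [].
by apply/eqP; rewrite dist_eq1 // e_sym cm.
Qed.

Let distsum_core i : i < k ->
  distsum e (x_ i) = \sum_(j < k) m i j + #|W| * (2 * m i 0 + 3).
Proof.
move=> ik; rewrite (distsum_sym e_sym e_conn) sum_loaded; congr (_ + _).
  by apply: eq_bigr => j _; rewrite loaded_dist_core.
rewrite (eq_bigr (fun=> 2 * m i 0 + 3)) ?sum_nat_const // => v vW.
by have [iv im] := W_neq ik vW; rewrite dist_tip // dist_mid // lam //; lia.
Qed.

Let W_card2 v : v \in W -> [/\ v != mu v, c != mu v, c != v & v \notin X].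
Proof.
move=> /WP[vX mX ev em _]; split=> //.
- by apply: contraTneq ev => ->; rewrite em.
- by apply: contraNneq mX => <-; rewrite mem_head.
- by apply: contraNneq vX => <-; rewrite mem_head.
Qed.

Let distsum_mid v : v \in W -> distsum e v + 4 = distsum e c + #|T|.
Proof.
move=> vW; have [vm cm cv _] := W_card2 vW; have [_ _ ev _ _] := WP vW.
apply: (distsum_pendant_path e_sym e_irr e_conn vm cm (@tipW v ^~ vW) (@midW v ^~ vW)).
  by rewrite e_sym e_mu.
by rewrite e_sym.
Qed.

Let distsum_tip v : v \in W -> distsum e (mu v) + 2 = distsum e v + #|T|.
Proof.
move=> vW; have [vm _ _ _] := W_card2 vW.
by apply: (distsum_leaf e_sym e_irr e_conn _ (@tipW v ^~ vW)); rewrite 1?eq_sym // e_sym e_mu.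
Qed.

(** This core vertex realises the eccentricities 3 and 4 on a pendant path even if there is no
    second path. *)
Let deep : exists2 j, j < k & m j 0 = 2.
Proof.
case/and5P: Mok => _ _ /bounded_allP msym _ /and3P[_ _ /hasP[j]].
rewrite mem_iota add0n => jk /eqP m2; exists j => //.
by have /bounded_allP/(_ 0 k_gt0)/eqP-> := msym _ jk.
Qed.

(** Every vertex is within 2 of the root, and the tip of a pendant path attains the resulting
    bound. *)
Let ecc_core i : 0 < #|W| -> i < k -> ecc e (x_ i) = (m i 0).+2.
Proof.
case/card_gt0P => v vW ik; apply/eqP; rewrite eqn_leq; apply/andP; split.
  apply/bigmax_leqP => u _; rewrite -(lam ik) (dist_sym e_sym e_conn).
  apply: leq_trans (dist_triangle e_conn _ c _) _.
  by have := dist_c u; rewrite (dist_sym e_sym e_conn u); lia.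
have [iv im] := W_neq ik vW.
by rewrite -(lam ik) -(dist_tip vW) // (dist_sym e_sym e_conn); exact: dist_le_ecc.
Qed.

Let ecc_mid v : v \in W -> ecc e v = 3.
Proof.
move=> vW; apply/eqP; rewrite eqn_leq; apply/andP; split.
  apply/bigmax_leqP => u _; case: (eqVneq u v) => [->|uv]; first by rewrite distxx.
  case: (eqVneq u (mu v)) => [->|um].
    suff -> : d (mu v) v = 1 by [].
    by apply/eqP; rewrite dist_eq1 // e_sym e_mu.
  by rewrite dist_mid // ltnS dist_c.
have [j jk mj] := deep; have [jv jm] := W_neq jk vW.
by have := dist_le_ecc e (x_ j) v; rewrite dist_mid // lam // mj.
Qed.

Let ecc_tip v : v \in W -> ecc e (mu v) = 4.
Proof.
move=> vW; apply/eqP; rewrite eqn_leq; apply/andP; split.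
  apply/bigmax_leqP => u _; case: (eqVneq u (mu v)) => [->|um]; first by rewrite distxx.
  case: (eqVneq u v) => [->|uv].
    suff -> : d v (mu v) = 1 by [].
    by apply/eqP; rewrite dist_eq1 // e_mu.
  by rewrite dist_tip // !ltnS dist_c.
have [j jk mj] := deep; have [jv jm] := W_neq jk vW.
by have := dist_le_ecc e (x_ j) (mu v); rewrite dist_tip // lam // mj.
Qed.

(** A middle vertex has eccentricity 3 and distance sum [distsum e c + #|T| - 4], a tip 4 and
    [distsum e c + 2 * #|T| - 6]. A pendant path thus contributes
    [7 * distsum e c + 11 * #|T| - 36], and 43 arises as 7 * 3 + 11 * 2. *)
Lemma loaded_ecc_dist_sum (r : nat) : #|T| = k + 2 * r -> 0 < r ->
  ecc_dist_sum e + 36 * r =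
  mx_sum M (fun i => (m i 0).+2 * mx_sum M (m i)) +
  r * (mx_sum M (fun i => (m i 0).+2 * (2 * m i 0 + 3)) +
       7 * mx_sum M (m 0) + 11 * k) + 43 * r ^ 2.
Proof.
move=> Tr r_gt0; have Wr : #|W| = r by have := card_loaded; rewrite Tr; lia.
rewrite /ecc_dist_sum sum_loaded !mx_sumE.
rewrite (eq_bigr (fun i : 'I_k => (m i 0).+2 * (\sum_(j < k) m i j) +
   r * ((m i 0).+2 * (2 * m i 0 + 3)))); last first.
  move=> i _; rewrite ecc_core ?Wr // distsum_core // Wr; lia.
have Dc : distsum e c = \sum_(j < k) m 0 j + r * 3.
  have := distsum_core k_gt0; rewrite Wr => /= ->; congr (_ + _ * _).
  by case/and5P: Mok => _ /bounded_allP/(_ 0 k_gt0)/eqP ->.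
(* Four vertices give [36 <= 11 * #|T|], so the truncated subtraction below is exact. *)
have k4 : 3 < k by case/and5P: Mok.
rewrite [X in _ + X + 36 * r]
  (eq_bigr (fun=> 7 * distsum e c + 11 * #|T| - 36)) => [|v vW]; last first.
  have := distsum_mid vW; have := distsum_tip vW; rewrite ecc_mid // ecc_tip //.
  by lia.
rewrite sum_nat_const Wr big_split /= -big_distrr /= Dc.
rewrite (eq_bigr (fun i : 'I_k => (m i 0).+2 * mx_sum M (m i))); last first.
  by move=> i _; rewrite mx_sumE.
rewrite Tr.
set S1 := \sum_(_ < _) _ * mx_sum _ _; set S2 := \sum_(_ < _) _ * (_ + _).
set S3 := \sum_(_ < _) m 0 _.
nia.
Qed.

End Loaded.

(** * A root of eccentricity at most 2 *)

Definition partner (i : nat) : nat := if odd i then i.-1 else i.+1.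

(* The core has vertices 0, ..., size fl - 1, matched in consecutive pairs; fl
   flags the neighbours of 0, and ext lists the remaining edges. *)
Definition core_adj (fl : seq bool) (ext : seq (nat * nat)) (i j : nat) : bool :=
  if i == 0 then nth false fl j else if j == 0 then nth false fl i else
  [|| j == partner i, (i, j) \in ext | (j, i) \in ext].

(** Breadth-first search: [ball i l] lists the vertices within distance [l] of [i], and an entry is
    the first radius that reaches [j]. *)
Definition core_mx (fl : seq bool) (ext : seq (nat * nat)) : seq (seq nat) :=
  let V := iota 0 (size fl) in
  let ball i l := iter l (fun S =>
    [seq j <- V | (j \in S) || has (core_adj fl ext j) S]) [:: i] in
  [seq [seq find (fun l => j \in ball i l) V | j <- V] | i <- V].

Definition core_ok (fl : seq bool) (ext : seq (nat * nat)) : bool :=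
  [&& 0 < size fl, all (fun a => (0 < a.1 < size fl) && (0 < a.2 < size fl)) ext &
      bounded_all (size fl) (fun i => bounded_all (size fl) (fun j =>
        (mx_entry (core_mx fl ext) i j == 1) == core_adj fl ext i j))].

Lemma size_core_mx fl ext : size (core_mx fl ext) = size fl.
Proof. by rewrite size_map size_iota. Qed.

Section Root.
Variables (T : finType) (e : rel T) (m : nat) (mu : T -> T) (c : T).
Hypotheses (e_sym : symmetric e) (e_irr : irreflexive e).
Hypothesis e_conn : connected_graph e.
Hypotheses (mu_inv : involutive mu) (e_mu : forall v, e v (mu v)).
Hypotheses (card_T : #|T| = 2 * m) (sum_deg_T : \sum_v deg e v = 4 * m).
Local Notation d := (dist e).

Lemma mu_neq v : mu v != v.
Proof. by apply: contraTneq (e_mu v) => ->; rewrite e_irr. Qed.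

(** The edges outside [mu] that avoid [c], each counted in both directions. *)
Definition free_arcs : {set T * T} :=
  [set p | [&& e p.1 p.2, p.1 != c, p.2 != c & p.2 != mu p.1]].

Definition unlinked : {set T} := [set v | [&& v != c, ~~ e c v & ~~ e c (mu v)]].

(** The ends of the matching edges that form a triangle with [c]. *)
Definition doubly_linked : {set T} :=
  [set v | [&& e c v, v != mu c & e c (mu v)]].

Lemma free_arcsE u v : u != c -> v != c -> e u v = (v == mu u) || ((u, v) \in free_arcs).
Proof.
move=> uc vc; rewrite inE /= uc vc /=; case: eqVneq => [->|_]; first by rewrite e_mu.
by rewrite andbT.
Qed.

Lemma free_arcs_sym u v : ((u, v) \in free_arcs) = ((v, u) \in free_arcs).
Proof.
rewrite !inE /= e_sym (eq_sym v (mu u)) (can2_eq mu_inv mu_inv).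
by case: (e v u); case: (u != c); case: (v != c); case: (u == mu v).
Qed.

(** The degree of [v <> c] counts its free arcs, possibly [c], and its partner unless that is [c].
    Summing over these [v] and adding [deg e c] must give [4 * m]. *)
Lemma card_free_arcs : #|free_arcs| + 2 * deg e c = 2 * m + 2.
Proof.
pose A := #|free_arcs|; rewrite -/A.
have degE v : v != c ->
    deg e v = \sum_u ((v, u) \in free_arcs) + e v c + (mu v != c).
  move=> vc; rewrite /deg (cardsD1 c) (cardsD1 (mu v)) !inE e_mu andbT addnA addnC.
  rewrite addnA; congr (_ + _ + _); rewrite -sum1_card big_mkcond.
  apply: eq_bigr => u _; rewrite !inE /= vc /=.
  by case: (e v u); case: (u == c); case: (u == mu v).
have sA : A = \sum_(v | v != c) \sum_u ((v, u) \in free_arcs).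
  transitivity (\sum_v \sum_u ((v, u) \in free_arcs)).
    rewrite pair_bigA /= /A -sum1_card big_mkcond; apply: eq_bigr => [[x y] _] /=.
    by case: (_ \in _).
  rewrite (bigD1 c) //= big1 ?add0n // => u _; by rewrite inE /= eqxx andbF.
have sc : \sum_(v | v != c) e v c = deg e c.
  rewrite /deg -sum1_card [RHS]big_mkcond [RHS](bigD1 c) //= inE e_irr add0n.
  by apply: eq_bigr => v _; rewrite inE e_sym; case: (e c v).
have smu : \sum_(v | v != c) (mu v != c) + 2 = 2 * m.
  rewrite (bigD1 (mu c)) ?mu_neq //= mu_inv eqxx add0n -card_T.
  rewrite (eq_bigr (fun=> 1)) => [|v /andP[vc vm]]; last first.
    by rewrite (can2_eq mu_inv mu_inv) vm.
  by rewrite sum1_card (card_neq2 (mu_neq c)).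
have := sum_deg_T; rewrite (bigD1 c) //= (eq_bigr _ degE) !big_split /= -sA sc.
lia.
Qed.

(** Inclusion-exclusion at each vertex [v] for the adjacencies of [v] and [mu v] to [c], summed over
    all [v]. *)
Lemma card_unlinked : #|unlinked| + 2 * deg e c = 2 * m + #|doubly_linked|.
Proof.
have dE := degE e c.
have dE' : deg e c = \sum_v e c (mu v).
  by rewrite dE (reindex_inj (inv_inj mu_inv)).
have cT : 2 * m = \sum_(v : T) 1 by rewrite -card_T sum_nat_const muln1.
rewrite mul2n -addnn {1}dE dE' !cardE_sum cT -!big_split /=; apply: eq_bigr => v _.
rewrite !inE; case: (eqVneq v c) => [->|vc]; first by rewrite e_irr e_mu.
case: (eqVneq v (mu c)) => [->|vm]; first by rewrite mu_inv e_irr e_mu.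
by case: (e c v); case: (e c (mu v)).
Qed.

Lemma doubly_linked_mu v : v \in doubly_linked -> mu v \in doubly_linked.
Proof.
rewrite !inE mu_inv => /and3P[ev _ em]; rewrite ev em andbT /=.
by apply: contraTneq ev => /(can_inj mu_inv) ->; rewrite e_irr.
Qed.

(** Once the core contains all free arcs, unlinked and doubly linked vertices, every matching edge
    outside it has exactly one end adjacent to [c] and no other edges: it is a pendant path. *)
Lemma core_loaded (s : seq T) (fl : seq bool) (ext : seq (nat * nat)) :
  core_ok fl ext -> uniq (c :: s) ->
  [seq e c v | v <- c :: s] = fl ->
  [seq mu v | v <- c :: s] = [seq nth c (c :: s) (partner i) | i <- iota 0 (size fl)] ->
  (forall i j, (i, j) \in ext -> e (nth c (c :: s) i) (nth c (c :: s) j)) ->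
  (forall u v, (u, v) \in free_arcs -> exists2 a, a \in ext &
     (u, v) = (nth c (c :: s) a.1, nth c (c :: s) a.2) \/
     (v, u) = (nth c (c :: s) a.1, nth c (c :: s) a.2)) ->
  {subset unlinked <= c :: s} -> {subset doubly_linked <= c :: s} ->
  loaded_by e (core_mx fl ext) c s mu.
Proof.
set X := c :: s; set x_ := nth c X.
case/and3P => fl0 /allP extP /bounded_allP okM uX flE muE extE freeE unlX dblX.
have sX : size X = size fl by rewrite -flE size_map.
have mu_x i : i < size fl -> mu (x_ i) = x_ (partner i).
  move=> ik; have := congr1 (fun t => nth c t i) muE.
  by rewrite (nth_map c) ?sX // (nth_map 0) ?size_iota // nth_iota.
have ec i : i < size fl -> e c (x_ i) = nth false fl i.
  by move=> ik; rewrite -flE (nth_map c) ?sX.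
have xc i : i < size fl -> (x_ i == c) = (i == 0).
  by move=> ik; rewrite -[c]/(x_ 0) nth_uniq ?sX.
have muX v : v \in X -> mu v \in X.
  move=> vX; have : mu v \in [seq mu v | v <- X] by apply: map_f.
  rewrite muE => /mapP[i _ ->].
  case: (ltnP (partner i) (size X)) => [pk|pk]; first exact: mem_nth.
  by rewrite /x_ nth_default // mem_head.
have inX i : i < size fl -> x_ i \in X by move=> ik; rewrite mem_nth ?sX.
have freeX u v : (u, v) \in free_arcs -> u \in X.
  by case/freeE => a /extP/andP[/andP[_ a1] /andP[_ a2]] [] [E1 E2];
  [rewrite E1|rewrite E2]; exact: inX.
split; rewrite ?size_core_mx //.
  move=> i j ik jk; have /bounded_allP/(_ _ jk)/eqP-> := okM _ ik.
  rewrite /core_adj -/x_; case: (eqVneq i 0) => [->|i0]; first by rewrite ec.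
  case: (eqVneq j 0) => [->|j0]; first by rewrite e_sym ec.
  rewrite free_arcsE ?xc // mu_x //; apply/orP/or3P.
    case=> [/eqP E|].
      case: (ltnP (partner i) (size fl)) => pk.
        by constructor 1; rewrite -(nth_uniq c _ _ uX) ?sX // -/x_ E.
      (* An index past the end of the core reads as the default [c], which occurs only at position
         0. *)
      have xp : x_ (partner i) = c by rewrite /x_ nth_default ?sX.
      by have := xc _ jk; rewrite E xp eqxx (negPf j0).
    case/freeE => -[a1 a2] aext; have /andP[/andP[_ l1] /andP[_ l2]] := extP _ aext.
    move: l1 l2 => /= l1 l2 [] [/eqP E1 /eqP E2]; move: E1 E2; rewrite !nth_uniq ?sX //.
      by move=> /eqP -> /eqP ->; constructor 2.
    by move=> /eqP -> /eqP ->; constructor 3.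
  case=> [/eqP->|/extE|/extE]; first by left.
    by rewrite -/x_ free_arcsE ?xc // mu_x // => /orP.
  by rewrite e_sym -/x_ free_arcsE ?xc // mu_x // => /orP.
move=> v vX; have vc : v != c by apply: contraNneq vX => ->; rewrite mem_head.
have mvX : mu v \notin X by apply: contra vX => /muX; rewrite mu_inv.
have mvc : mu v != c by apply: contraNneq mvX => ->; rewrite mem_head.
have vmc : v != mu c by apply: contraNneq mvc => ->; rewrite mu_inv.
split=> //.
  have : v \notin unlinked by apply: contra vX; exact: unlX.
  have : v \notin doubly_linked by apply: contra vX; exact: dblX.
  rewrite !inE vc vmc /=.
  by case: (e c v); case: (e c (mu v)).
move=> u; case: (eqVneq u c) => [->|uc].
  by rewrite eq_sym (negPf mvc) e_sym.
rewrite free_arcsE // orbF; case: (boolP (_ \in _)) => [/freeX|]; first by rewrite (negPf vX).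
by rewrite orbF.
Qed.

End Root.

(** The constant and the linear coefficient, in the number [r] of pendant paths, of the right-hand
    side of [loaded_ecc_dist_sum]. *)
Definition core_coeffs (fl : seq bool) (ext : seq (nat * nat)) : nat * nat :=
  let M := core_mx fl ext in let m := mx_entry M in
  (mx_sum M (fun i => (m i 0).+2 * mx_sum M (m i)),
   mx_sum M (fun i => (m i 0).+2 * (2 * m i 0 + 3)) +
       7 * mx_sum M (m 0) + 11 * size M).

(** [U_flags] is a triangle with a pendant vertex at the root. [U'_flags] is a tree until an extra
    edge closes a cycle; the edge (3, 5) makes it a 5-cycle with a pendant vertex. [R_flags] is a
    path on four vertices. *)
Definition U_flags := [:: false; true; true; true].
Definition U'_flags := [:: false; true; true; false; true; false].
Definition R_flags := [:: false; true; true; false].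
Definition U'_ext := [:: (3, 5)].

(** * Classification of the cores around the root *)

Section SmallEccentricity.
Variables (T : finType) (e : rel T) (m : nat) (mu : T -> T) (c : T).
Hypotheses (e_sym : symmetric e) (e_irr : irreflexive e).
Hypothesis e_conn : connected_graph e.
Hypotheses (mu_inv : involutive mu) (e_mu : forall v, e v (mu v)).
Hypotheses (card_T : #|T| = 2 * m) (sum_deg_T : \sum_v deg e v = 4 * m).
Local Notation d := (dist e).
Local Notation free_arcs := (free_arcs e mu c).
Local Notation unlinked := (unlinked e mu c).
Local Notation doubly_linked := (doubly_linked e mu c).
Let muN := mu_neq e_irr e_mu.

Definition pairs (t : seq T) : seq T := flatten [seq [:: v; mu v] | v <- t].

Lemma mem_pairs (t : seq T) v : (v \in pairs t) = (v \in t) || (mu v \in t).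
Proof.
elim: t => //= x t IH; rewrite !inE IH -(can2_eq mu_inv mu_inv).
by case: (v == x); case: (mu v == x); case: (v \in t).
Qed.

Lemma uniq_pairs (t : seq T) :
  uniq t -> (forall v, v \in t -> mu v \notin t) -> uniq (pairs t).
Proof.
elim: t => //= x t IH /andP[xt ut] sep.
rewrite !inE (eq_sym x) (negPf (muN x)) /= !mem_pairs mu_inv.
have := sep x (mem_head _ _); rewrite inE (negPf (muN x)) /= => mxt.
rewrite (negPf xt) (negPf mxt) /=; apply: IH => // v vt.
by have := sep v; rewrite !inE vt orbT => /(_ isT); rewrite negb_or => /andP[].
Qed.

(** A shortest walk to a vertex at distance 3 or more ends with two consecutive edges avoiding [c];
    both would be matching edges. *)
Lemma free_arcs0_dist : free_arcs = set0 -> forall v, d c v <= 2.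
Proof.
move=> A0 v; have freeE x y : x != c -> y != c -> e x y -> y = mu x.
  by move=> xc yc; rewrite (free_arcsE e_mu xc yc) A0 inE orbF => /eqP.
rewrite leqNgt; apply/negP => lt2.
case E : (d c v) lt2 => [|[|[|k]]] // _.
have [x dx exv] := dist_pred e_conn E; have [y dy eyx] := dist_pred e_conn dx.
have nc w j : d c w = j.+1 -> w != c by move=> dw; rewrite eq_sym -(dist_gt0 e_conn) dw.
have vx := freeE _ _ (nc _ _ dx) (nc _ _ E) exv.
have xy := freeE _ _ (nc _ _ dy) (nc _ _ dx) eyx.
by move: E; rewrite vx xy mu_inv dy => /eqP; rewrite !eqSS; elim: (k).
Qed.

Lemma big_deg_dist : m < deg e c -> forall v, d c v <= 2.
Proof.
move=> md; apply: free_arcs0_dist; apply/eqP; rewrite -cards_eq0.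
have := card_free_arcs c e_sym e_irr mu_inv e_mu card_T sum_deg_T; lia.
Qed.

Lemma linked (v : T) : d c v <= 2 -> v \in unlinked -> exists2 x, e c x & (v, x) \in free_arcs.
Proof.
move=> d2; rewrite inE => /and3P[vc ev em].
have [x dx exv] : exists2 x, d c x = 1 & e x v.
  apply: (dist_pred e_conn); apply/eqP; rewrite eqn_leq d2 /=.
  by apply: dist_ge2; rewrite // eq_sym.
move/eqP: dx; rewrite (dist_eq1 e_irr e_conn) => ecx; exists x => //.
rewrite inE /= e_sym exv vc /=; apply/andP; split.
  by apply: contraTneq ecx => ->; rewrite e_irr.
by apply: contraTneq ecx => ->.
Qed.

Section Depth2.
Hypothesis depth2 : forall v, d c v <= 2.

(** Each unlinked [v] has a free edge to a neighbour [h v] of [c]. Its two directions are never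
    confused, since [h v] is adjacent to [c] and unlinked vertices are not. *)
Lemma card_unlinked_free : 2 * #|unlinked| <= #|free_arcs|.
Proof.
pose h v := odflt c [pick x | e c x && ((v, x) \in free_arcs)].
have hP v : v \in unlinked -> e c (h v) /\ (v, h v) \in free_arcs.
  move=> vU; rewrite /h; case: pickP => [x /andP[]//|none].
  by have [x ex vx] := linked (depth2 v) vU; have := none x; rewrite ex vx.
have c1 : #|[set (v, h v) | v in unlinked]| = #|unlinked| by rewrite card_imset // => x y [].
have c2 : #|[set (h v, v) | v in unlinked]| = #|unlinked| by rewrite card_imset // => x y [].
have dis : [disjoint [set (v, h v) | v in unlinked] & [set (h v, v) | v in unlinked]].
  apply/pred0P => a /=; apply/negP => /andP[/imsetP[x xU ->] /imsetP[y yU [E1 E2]]].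
  by have [ec _] := hP _ yU; move: xU; rewrite E1 inE ec andbF.
rewrite mul2n -addnn -{1}c1 -c2 -(cardsUI) (disjoint_setI0 dis) cards0 addn0.
apply: subset_leq_card; apply/subsetP => a; rewrite in_setU => /orP[] /imsetP[v /hP[_ vf] ->] //.
by rewrite (free_arcs_sym c e_sym mu_inv).
Qed.

(** The two counts give [#|unlinked| + 2 = #|free_arcs| + #|doubly_linked|]; with
    [card_unlinked_free] this yields [#|free_arcs| + 2 * #|doubly_linked| <= 4], and [#|free_arcs|]
    is even. *)
Lemma depth2_cases :
  [\/ [/\ free_arcs = set0, unlinked = set0 & #|doubly_linked| = 2],
      [/\ #|free_arcs| = 2, unlinked = set0 & doubly_linked = set0] |
      [/\ #|free_arcs| = 4, #|unlinked| = 2 & doubly_linked = set0]].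
Proof.
have := card_free_arcs c e_sym e_irr mu_inv e_mu card_T sum_deg_T.
have := card_unlinked c e_irr mu_inv e_mu card_T.
have := card_unlinked_free.
(* The set is closed under [mu], which has no fixed point. *)
have n1 : #|doubly_linked| <> 1.
  move/eqP/cards1P => [x E]; have xD : x \in doubly_linked by rewrite E inE.
  by have := doubly_linked_mu e_irr mu_inv xD; rewrite E inE (negPf (muN x)).
move: n1; set A := #|free_arcs|; set Z := #|unlinked|; set W := #|doubly_linked|.
move=> n1 h1 h2 h3.
have : [\/ [/\ A = 0, Z = 0 & W = 2], [/\ A = 2, Z = 0 & W = 0] |
            [/\ A = 4, Z = 2 & W = 0]].
  have [W0|[W2|W3]] : W = 0 \/ W = 2 \/ 2 < W by lia.
  - have [Z0|Z2] : Z = 0 \/ Z = 2 by lia.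
      by constructor 2; split=> //; lia.
    by constructor 3; split=> //; lia.
  - by constructor 1; split=> //; lia.
  - lia.
case=> [[/eqP A0 /eqP Z0 W2]|[A2 /eqP Z0 /eqP W0]|[A4 Z2 /eqP W0]].
- by constructor 1; move: A0 Z0; rewrite !cards_eq0 => /eqP -> /eqP ->.
- by constructor 2; move: W0 Z0; rewrite !cards_eq0 => /eqP -> /eqP ->.
- by constructor 3; move: W0; rewrite !cards_eq0 => /eqP ->.
Qed.

Lemma core_ecc_dist_sum s fl ext r : loaded_by e (core_mx fl ext) c s mu ->
  dist_matrix (core_mx fl ext) -> 2 * m = size fl + 2 * r -> 0 < r ->
  ecc_dist_sum e + 36 * r =
  (core_coeffs fl ext).1 + r * (core_coeffs fl ext).2 + 43 * r ^ 2.
Proof.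
move=> L ok mr r0; apply: (loaded_ecc_dist_sum e_sym e_irr e_conn ok L) => //.
by rewrite size_core_mx card_T.
Qed.

End Depth2.
Let freeI u v := @free_arcs_sym T e mu c e_sym mu_inv u v.

Lemma free_arcs_pair u v : (u, v) \in free_arcs ->
  [/\ e u v, u != c, v != c, v != mu u & u != v].
Proof.
rewrite inE /= => /and4P[euv uc vc vm]; split=> //.
by apply: contraTneq euv => ->; rewrite e_irr.
Qed.

Lemma nth_partner (t : seq T) i : i < size (pairs t) ->
  nth c (pairs t) (partner i) = mu (nth c (pairs t) i).
Proof.
elim: t i => //= x t IH [|[|i]] //=; rewrite !ltnS => it; rewrite -IH // /partner /= negbK.
by case: i {it} => [|i] //=; case: odd.
Qed.

Lemma loaded_pairs (t : seq T) (fl : seq bool) (ext : seq (nat * nat)) :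
  let X := pairs (c :: t) in
  core_ok fl ext -> uniq (c :: t) -> (forall v, v \in c :: t -> mu v \notin c :: t) ->
  [seq e c v | v <- X] = fl ->
  all (fun a => (nth c X a.1, nth c X a.2) \in free_arcs) ext ->
  (forall u v, (u, v) \in free_arcs ->
    has (fun a => ((u, v) == (nth c X a.1, nth c X a.2)) ||
                  ((v, u) == (nth c X a.1, nth c X a.2))) ext) ->
  {subset unlinked <= X} -> {subset doubly_linked <= X} ->
  loaded_by e (core_mx fl ext) c (behead X) mu.
Proof.
move=> X ok ut sep flE /allP extE freeE unlX dblX.
have XE : c :: behead X = X by [].
have sX : size X = size fl by rewrite -flE size_map.
have muX : [seq mu v | v <- X] = [seq nth c X (partner i) | i <- iota 0 (size fl)].
  apply: (@eq_from_nth _ c) => [|i]; rewrite !size_map ?size_iota // => ik.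
  rewrite (nth_map c) // (nth_map 0) ?size_iota -?sX // nth_iota -?sX // add0n.
  by rewrite nth_partner.
apply: (core_loaded e_sym mu_inv e_mu ok); rewrite XE //.
- exact: uniq_pairs.
- by move=> i j /extE /free_arcs_pair[].
move=> u v /freeE/hasP[a aext /orP[/eqP E|/eqP E]]; exists a; rewrite // E.
  by left.
by right.
Qed.

Definition U_like := exists s, loaded_by e (core_mx U_flags [::]) c s mu.
Definition U'_like := exists s, loaded_by e (core_mx U'_flags U'_ext) c s mu.
Definition large_eds := 43 * m ^ 2 < ecc_dist_sum e + 72 * m + 4.

Lemma doubly_linked_card2 : free_arcs = set0 -> unlinked = set0 -> #|doubly_linked| = 2 ->
  U_like.
Proof.
move=> A0 Z0 D2; have [x xD] : exists x, x \in doubly_linked.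
  by apply/card_gt0P; rewrite D2.
have mD := doubly_linked_mu e_irr mu_inv xD.
have DE : doubly_linked = [set x; mu x].
  apply/esym/eqP; rewrite eqEcard D2 cards2 eq_sym muN andbT.
  by apply/subsetP => v; rewrite !inE => /orP[] /eqP ->; [move: xD|move: mD]; rewrite inE.
move: xD; rewrite inE => /and3P[ecx xm ecm].
have cx : c != x by apply: contraTneq ecx => <-; rewrite e_irr.
exists (behead (pairs [:: c; x])); apply: loaded_pairs => //=.
- by rewrite inE cx.
- move=> v; rewrite !inE => /orP[]/eqP ->; rewrite negb_or muN.
    by rewrite eq_sym xm.
  by rewrite andbT; apply: contraTneq ecm => ->; rewrite e_irr.
- by rewrite e_irr e_mu ecx ecm.
- by move=> u v; rewrite A0 inE.
- by rewrite Z0 => v; rewrite inE.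
- by rewrite DE => v; rewrite !inE => /orP[] /eqP ->; rewrite eqxx ?orbT.
Qed.

(** With [m = k + r] both sides of [large_eds] are quadratics in [r] with leading coefficient 43, so
    it suffices to compare the constant and the linear coefficients. The test [k < 5] leaves
    [0 < r]. *)
Definition large_core fl ext k : bool :=
  [&& core_ok fl ext && dist_matrix (core_mx fl ext), size fl == 2 * k, k < 5,
      43 * k ^ 2 < (core_coeffs fl ext).1 + 72 * k + 4 &
      86 * k <= (core_coeffs fl ext).2 + 36].

Lemma large_core_ok fl ext k : large_core fl ext k -> core_ok fl ext.
Proof. by case/and5P => /andP[]. Qed.

Lemma core_large s fl ext k : 5 <= m -> large_core fl ext k ->
  loaded_by e (core_mx fl ext) c s mu -> large_eds.
Proof.
rewrite /large_core; move: (core_coeffs fl ext) (@core_ecc_dist_sum s fl ext (m - k)).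
case=> a b /= eds m5 /and5P[/andP[_ ok] /eqP sk k5 h1 h2] L.
have {}eds := eds L ok (ltac:(lia)) (ltac:(lia)).
rewrite /large_eds; have [r mr] : exists r, m = k + r by exists (m - k); lia.
rewrite mr addKn in eds *; nia.
Qed.

Definition mid (v : T) : bool := e c v && (v != mu c).

Section NoDoublyLinked.
Hypotheses (D0 : doubly_linked = set0) (m5 : 5 <= m).

Lemma mid_mu v : mid v -> e c (mu v) = false.
Proof.
case/andP=> ev vm; apply: contra_eqF D0 => em; apply/set0Pn; exists v.
by rewrite inE ev vm.
Qed.

Lemma mid_neq v : mid v -> [/\ v != c, v != mu c, mu v != c & mu v != mu c].
Proof.
case/andP=> ev vm; have vc : v != c by apply: contraTneq ev => ->; rewrite e_irr.
split=> //; last by rewrite (inj_eq (can_inj mu_inv)).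
by apply: contraNneq vm => <-; rewrite mu_inv.
Qed.

Let flag x : mid x -> (e c x = true) * (e c (mu x) = false).
Proof. by move=> xM; rewrite mid_mu //; case/andP: xM. Qed.

Lemma mids_uniq t : all mid t -> uniq t -> uniq (c :: t).
Proof.
move=> /allP tm ut; rewrite /= ut andbT.
by apply/negP => /tm /mid_neq[]; rewrite eqxx.
Qed.

Lemma mids_sep t : all mid t -> forall v, v \in c :: t -> mu v \notin c :: t.
Proof.
move=> /allP tm v; rewrite !inE => /predU1P[->|/tm vm].
  by rewrite (negPf (muN c)) /=; apply/negP => /tm /mid_neq[_]; rewrite eqxx.
have [_ _ /negPf -> _] := mid_neq vm => /=.
by apply/negP => /tm /andP[]; rewrite mid_mu.
Qed.

Section OneFreeEdge.
Hypothesis Z0 : unlinked = set0.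

Lemma one_linked v : v != c -> e c (mu v) = ~~ e c v.
Proof.
move=> vc; case: (eqVneq v (mu c)) => [->|vm]; first by rewrite mu_inv e_irr e_mu.
have : v \notin unlinked by rewrite Z0 inE.
have : v \notin doubly_linked by rewrite D0 inE.
by rewrite !inE vc vm /=; case: (e c v); case: (e c (mu v)).
Qed.

Lemma leaf_mid v : v != c -> ~~ e c v -> mid (mu v).
Proof.
by move=> vc ev; rewrite /mid one_linked // ev (inj_eq (can_inj mu_inv)).
Qed.

Lemma one_free_loaded (p q : T) (t : seq T) fl (i j : nat) :
  let X := pairs (c :: t) in
  (p, q) \in free_arcs ->
  (forall u v, (u, v) \in free_arcs -> (u, v) = (p, q) \/ (v, u) = (p, q)) ->
  core_ok fl [:: (i, j)] -> all mid t -> uniq t ->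
  [seq e c v | v <- X] = fl ->
  nth c X i = p -> nth c X j = q ->
  loaded_by e (core_mx fl [:: (i, j)]) c (behead X) mu.
Proof.
move=> X pqA AE ok tm ut flE ip jq.
apply: loaded_pairs; rewrite -/X //=.
- exact: mids_uniq.
- exact: mids_sep.
- by rewrite ip jq pqA.
- by move=> u v /AE; rewrite ip jq => -[->|->]; rewrite eqxx ?orbT.
- by rewrite Z0 => v; rewrite inE.
- by rewrite D0 => v; rewrite inE.
Qed.

Lemma leafP v : v != c -> ~~ e c v -> exists2 x, mid x & v = mu x.
Proof. by move=> vc ev; exists (mu v); rewrite ?mu_inv //; exact: leaf_mid. Qed.

(** The free edge closes a triangle through [c] and [mu c] if [q] is adjacent to [c], and a 4-cycle
    otherwise. *)
Lemma free_at_partner p q : (p, q) \in free_arcs ->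
  (forall u v, (u, v) \in free_arcs -> (u, v) = (p, q) \/ (v, u) = (p, q)) ->
  p = mu c -> large_eds.
Proof.
move=> pqA AE pE; have [epq pc qc qm pq] := free_arcs_pair pqA.
case: (boolP (e c q)) => ecq.
  have qM : mid q by rewrite /mid ecq -pE eq_sym.
  have ok : large_core R_flags [:: (1, 2)] 2 by vm_compute.
  apply: (core_large (s := behead (pairs [:: c; q])) m5 ok).
  apply: (one_free_loaded pqA AE (large_core_ok ok)); clear ok; rewrite /= ?qM //.
    by rewrite e_irr e_mu !(flag qM).
have [x xM xE] := leafP qc ecq.
have ok : large_core R_flags [:: (1, 3)] 2 by vm_compute.
apply: (core_large (s := behead (pairs [:: c; x])) m5 ok).
apply: (one_free_loaded pqA AE (large_core_ok ok)); clear ok; rewrite /= ?xM //.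
  by rewrite e_irr e_mu !(flag xM).
Qed.

(** The cycle is a triangle [c], [p], [q] if [q] is adjacent to [c], and the 4-cycle [c], [p], [q],
    [mu q] otherwise. *)
Lemma free_from_mid p q : (p, q) \in free_arcs ->
  (forall u v, (u, v) \in free_arcs -> (u, v) = (p, q) \/ (v, u) = (p, q)) ->
  mid p -> q != mu c -> large_eds.
Proof.
move=> pqA AE pM qa; have [epq pc qc qm pq] := free_arcs_pair pqA.
case: (boolP (e c q)) => ecq.
  have qM : mid q by rewrite /mid ecq.
  have ok : large_core U'_flags [:: (2, 4)] 3 by vm_compute.
  apply: (core_large (s := behead (pairs [:: c; p; q])) m5 ok).
  apply: (one_free_loaded pqA AE (large_core_ok ok)); clear ok; rewrite /= ?inE ?pM ?qM ?andbT //.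
    by rewrite e_irr e_mu !(flag pM) !(flag qM).
have [x xM xE] := leafP qc ecq.
have ok : large_core U'_flags [:: (2, 5)] 3 by vm_compute.
apply: (core_large (s := behead (pairs [:: c; p; x])) m5 ok).
apply: (one_free_loaded pqA AE (large_core_ok ok)); clear ok; rewrite /= ?inE ?pM ?xM ?andbT //.
- by apply: contraNneq qm => ->; rewrite xE.
- by rewrite e_irr e_mu !(flag pM) !(flag xM).
Qed.

(** An edge between the tips of two pendant paths closes the 5-cycle [c], [mu p], [p], [q],
    [mu q]. *)
Lemma free_leaves p q : (p, q) \in free_arcs ->
  (forall u v, (u, v) \in free_arcs -> (u, v) = (p, q) \/ (v, u) = (p, q)) ->
  ~~ e c p -> ~~ e c q -> U'_like.
Proof.
move=> pqA AE ecp ecq; have [epq pc qc qm pq] := free_arcs_pair pqA.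
have [x xM xE] := leafP pc ecp; have [y yM yE] := leafP qc ecq.
exists (behead (pairs [:: c; x; y])).
have ok : core_ok U'_flags U'_ext by vm_compute.
apply: (one_free_loaded pqA AE ok); clear ok; rewrite /= ?inE ?xM ?yM ?andbT //.
- by apply: contraNneq pq => xy; rewrite xE yE xy.
- by rewrite e_irr e_mu !(flag xM) !(flag yM).
Qed.

Lemma one_free_edge : #|free_arcs| = 2 -> U'_like \/ large_eds.
Proof.
move=> A2; have [[p q] pqA] : exists a, a \in free_arcs by apply/card_gt0P; rewrite A2.
have qpA : (q, p) \in free_arcs by rewrite freeI.
have [epq pc qc qm pq] := free_arcs_pair pqA.
have AE u v : (u, v) \in free_arcs -> (u, v) = (p, q) \/ (v, u) = (p, q).
  suff -> : free_arcs = [set (p, q); (q, p)].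
    by rewrite !inE => /orP[] /eqP[-> ->]; [left|right].
  apply/esym/eqP; rewrite eqEcard A2 cards2 xpair_eqE negb_and pq andbT.
  by apply/subsetP => a; rewrite !inE => /orP[] /eqP ->; [move: pqA|move: qpA]; rewrite inE.
have AE' u v : (u, v) \in free_arcs -> (u, v) = (q, p) \/ (v, u) = (q, p).
  by case/AE => -[-> ->]; [right|left].
case: (eqVneq p (mu c)) => [pa|pa]; first by right; exact: (free_at_partner pqA).
case: (eqVneq q (mu c)) => [qa|qa]; first by right; exact: (free_at_partner qpA).
case: (boolP (e c p)) => ecp.
  by right; apply: (free_from_mid pqA); rewrite // /mid ecp.
case: (boolP (e c q)) => ecq.
  by right; apply: (free_from_mid qpA); rewrite // /mid ecq.
by left; exact: (free_leaves pqA).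
Qed.

End OneFreeEdge.

Section TwoFreeEdges.
Hypothesis depth2 : forall v, d c v <= 2.
Hypotheses (A4 : #|free_arcs| = 4) (Z2 : #|unlinked| = 2).

(** The unlinked vertices are [y] and [mu y], joined to neighbours [x] and [x'] of [c] by the only
    two free edges. The cases are whether [x] or [x'] is [mu c] and whether they coincide. *)
Lemma two_free_edges : large_eds.
Proof.
have [y yZ] : exists y, y \in unlinked by apply/card_gt0P; rewrite Z2.
have yZ' := yZ; rewrite inE in yZ'; case/and3P: yZ' => yc ecy ecmy.
have myc : mu y != c by apply: contraNneq ecy => <-; rewrite e_sym e_mu.
have ya : y != mu c by apply: contraNneq myc => ->; rewrite mu_inv.
have mZ : mu y \in unlinked by rewrite inE myc mu_inv ecmy ecy.
have ZE : unlinked = [set y; mu y].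
  apply/esym/eqP; rewrite eqEcard Z2 cards2 eq_sym muN andbT.
  by apply/subsetP => v; rewrite in_set2 => /orP[] /eqP ->.
have [x ecx yxA] := linked (depth2 y) yZ.
have [x' ecx' yx'A] := linked (depth2 (mu y)) mZ.
have neq v w : e c v -> ~~ e c w -> v != w by move=> ev; apply: contraNneq => <-.
have AE u v : (u, v) \in free_arcs ->
    ((u, v) == (x, y)) || ((v, u) == (x, y)) || ((u, v) == (x', mu y)) || ((v, u) == (x', mu y)).
  suff -> : free_arcs = [set a in [:: (x, y); (y, x); (x', mu y); (mu y, x')]].
    by rewrite !inE !xpair_eqE; case/or4P => /andP[-> ->]; rewrite ?orbT.
  apply/esym/eqP; rewrite eqEcard A4; apply/andP; split.
    apply/subsetP => a aL.
    have /or4P : [|| a == (x, y), a == (y, x), a == (x', mu y) | a == (mu y, x')].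
      by move: aL; rewrite !inE.
    by case=> /eqP ->; rewrite // freeI.
  rewrite cardsE (card_uniqP _) //= !inE !xpair_eqE !negb_or !negb_and.
  have ym : y != mu y by rewrite eq_sym.
  by rewrite ym (neq x y) ?(neq x (mu y)) ?(neq x' (mu y)) // (eq_sym y x') (neq x' y) ?orbT.
(* Positions 0 and 1 hold [c] and [mu c], positions 2 and 3 hold [y] and [mu y]; [i] and [j] locate
   [x] and [x']. *)
have loaded t fl i j k : let X := pairs (c :: y :: t) in
    all mid t -> uniq t -> large_core fl [:: (i, 2); (j, 3)] k ->
    [seq e c v | v <- X] = fl ->
      nth c X i = x -> nth c X j = x' -> large_eds.
  move=> X tm ut large flE ix jx'; apply: (core_large m5 large).
  have ty v : v \in t -> (v != y) && (v != mu y).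
    by move=> /(allP tm)/andP[ev _]; rewrite !neq.
  apply: (loaded_pairs (t := y :: t) (large_core_ok large)); rewrite -/X //=.
  - have := mids_uniq tm ut; rewrite /= !inE negb_or eq_sym yc => /andP[-> ->] /=.
    by rewrite andbT; apply/negP => /ty; rewrite eqxx.
  - have sep := mids_sep tm; move=> v; rewrite inE => /predU1P[->|].
      rewrite !inE !negb_or (muN c) (eq_sym _ y) ya /=; have := sep c (mem_head _ _).
      by rewrite inE negb_or => /andP[].
    rewrite inE => /predU1P[->|vt].
      rewrite !inE !negb_or myc muN /=; apply/negP => /ty; by rewrite eqxx andbF.
    have := sep v; rewrite inE vt orbT => /(_ isT); rewrite !inE !negb_or => /andP[-> ->].
    have /andP[_ vm] := ty _ vt; rewrite andbT /=.
    by apply: contraNneq vm => <-; rewrite mu_inv.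
  - by rewrite ix jx' (freeI x y) yxA (freeI x' (mu y)) yx'A.
  - move=> u v /AE; rewrite ix jx'.
    by rewrite orbF -!orbA.
  - by move=> v; rewrite ZE !inE => /orP[] /eqP ->; rewrite eqxx ?orbT.
  - by rewrite D0 => v; rewrite inE.
have ey := (negPf ecy, negPf ecmy).
case: (eqVneq x (mu c)) => [xa|xa]; case: (eqVneq x' (mu c)) => [x'a|x'a].
- have ok : large_core [:: false; true; false; false] [:: (1, 2); (1, 3)] 2 by vm_compute.
  apply: (loaded [::] _ 1 1 2 _ _ ok); clear ok; rewrite //=.
    by rewrite e_irr e_mu !ey.
- have x'M : mid x' by rewrite /mid ecx'.
  have ok : large_core [:: false; true; false; false; true; false]
      [:: (1, 2); (4, 3)] 3 by vm_compute.
  apply: (loaded [:: x'] _ 1 4 3 _ _ ok); clear ok; rewrite //=.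
  + by rewrite x'M.
  + by rewrite e_irr e_mu !ey !(flag x'M).
- have xM : mid x by rewrite /mid ecx.
  have ok : large_core [:: false; true; false; false; true; false]
      [:: (4, 2); (1, 3)] 3 by vm_compute.
  apply: (loaded [:: x] _ 4 1 3 _ _ ok); clear ok; rewrite //=.
  + by rewrite xM.
  + by rewrite e_irr e_mu !ey !(flag xM).
have xM : mid x by rewrite /mid ecx.
have x'M : mid x' by rewrite /mid ecx'.
case: (eqVneq x x') => [xx'|xx'].
  have ok : large_core [:: false; true; false; false; true; false]
      [:: (4, 2); (4, 3)] 3 by vm_compute.
  apply: (loaded [:: x] _ 4 4 3 _ _ ok); clear ok; rewrite //=.
  + by rewrite xM.
  + by rewrite e_irr e_mu !ey !(flag xM).
have ok : large_core [:: false; true; false; false; true; false; true; false]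
    [:: (4, 2); (6, 3)] 4 by vm_compute.
apply: (loaded [:: x; x'] _ 4 6 4 _ _ ok); clear ok; rewrite //=.
+ by rewrite xM x'M.
+ by rewrite inE xx'.
+ by rewrite e_irr e_mu !ey !(flag xM) !(flag x'M).
Qed.

End TwoFreeEdges.
End NoDoublyLinked.

Lemma depth2_classification : 5 <= m -> (forall v, d c v <= 2) ->
  [\/ U_like, U'_like | large_eds].
Proof.
move=> m5 depth2; case: (depth2_cases depth2) => [[A0 Z0 D2]|[A2 Z0 D0]|[A4 Z2 D0]].
- by constructor 1; exact: doubly_linked_card2.
- by case: (one_free_edge D0 m5 Z0 A2); [constructor 2|constructor 3].
by constructor 3; exact: two_free_edges.
Qed.

(** With [r = m - 3] pendant paths the value is 43 r^2 + 186 r + 167. *)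
Lemma U'_like_ecc_dist_sum : 5 <= m -> U'_like -> ecc_dist_sum e + 72 * m + 4 = 43 * m ^ 2.
Proof.
move=> m5 [s L]; have := @core_ecc_dist_sum s _ _ (m - 3) L.
have -> : core_coeffs U'_flags U'_ext = (167, 222) by vm_compute.
have [r mr] : exists r, m = 3 + r by exists (m - 3); lia.
rewrite mr addKn /= => H; have {}H := H isT (ltac:(lia)) (ltac:(lia)); nia.
Qed.

End SmallEccentricity.

(** * Isomorphisms of loaded graphs *)

Section LoadedMap.
Variables (T T' : finType) (e : rel T) (e' : rel T').
Variables (c : T) (s : seq T) (mu : T -> T) (c' : T') (s' : seq T') (mu' : T' -> T').

Definition mids (T : finType) (e : rel T) (c : T) (s : seq T) : {set T} :=
  [set v | (v \notin c :: s) && e c v].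

(** The pendant paths are interchangeable, so they are matched by their rank in the enumerations. *)
Definition mid_map (v : T) : T' :=
  nth c' (enum (mids e' c' s')) (index v (enum (mids e c s))).

Definition loaded_map (v : T) : T' :=
  if v \in c :: s then nth c' (c' :: s') (index v (c :: s))
  else if e c v then mid_map v else mu' (mid_map (mu v)).

Variable M : seq (seq nat).
Hypotheses (L : loaded_by e M c s mu) (L' : loaded_by e' M c' s' mu').
Hypothesis card_mids : #|mids e c s| = #|mids e' c' s'|.

Lemma mid_map_in v : v \in mids e c s -> mid_map v \in mids e' c' s'.
Proof.
by move=> vW; rewrite -mem_enum mem_nth // -cardE -card_mids cardE index_mem mem_enum.
Qed.

Lemma mid_of v : v \notin c :: s -> ~~ e c v -> mu v \in mids e c s.
Proof.
by move=> vX ev; rewrite inE; case: L => _ _ _ /(_ v vX)[-> _ -> _]; rewrite ev.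
Qed.

Lemma loaded_map_core v : v \in c :: s ->
  loaded_map v \in c' :: s' /\ index (loaded_map v) (c' :: s') = index v (c :: s).
Proof.
move=> vX; rewrite /loaded_map vX; case: L L' => _ sX _ _ [uX' sX' _ _].
have iX : index v (c :: s) < size (c' :: s') by rewrite sX' -sX index_mem.
by rewrite mem_nth // index_uniq.
Qed.

Lemma loaded_map_off v : v \notin c :: s ->
  [/\ loaded_map v \notin c' :: s', e' c' (loaded_map v) = e c v &
      loaded_map (mu v) = mu' (loaded_map v)].
Proof.
move=> vX; case: L L' => _ _ _ /(_ v vX)[mX mm cm _] [_ _ _ off'].
rewrite /loaded_map (negPf vX) (negPf mX) cm; case: (boolP (e c v)) => ev /=.
  have : v \in mids e c s by rewrite inE vX.
  by move/mid_map_in; rewrite inE => /andP[-> ->]; rewrite mm.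
have := mid_map_in (mid_of vX ev); rewrite inE => /andP[hX ch].
by have [-> mm' -> _] := off' _ hX; rewrite ch mm'.
Qed.

End LoadedMap.

Lemma loaded_mapK (T T' : finType) (e : rel T) (e' : rel T')
    (c : T) (s : seq T) (mu : T -> T) (c' : T') (s' : seq T') (mu' : T' -> T') M :
  loaded_by e M c s mu -> loaded_by e' M c' s' mu' ->
  #|mids e c s| = #|mids e' c' s'| ->
  cancel (loaded_map e e' c s mu c' s' mu') (loaded_map e' e c' s' mu' c s mu).
Proof.
move=> L L' cW.
have midK v : v \in mids e c s -> mid_map e' e c' s' c s (mid_map e e' c s c' s' v) = v.
  move=> vW; have iv : index v (enum (mids e c s)) < size (enum (mids e' c' s')).
    by rewrite -cardE -cW cardE index_mem mem_enum.
  by rewrite /mid_map index_uniq ?enum_uniq // nth_index // mem_enum.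
move=> v; case: (boolP (v \in c :: s)) => vX.
  have [fX fi] := loaded_map_core L L' vX.
  by rewrite {1}/loaded_map fX fi nth_index.
have [fX fe fm] := loaded_map_off L L' cW vX.
rewrite {1}/loaded_map (negPf fX) fe -fm; have [mX mm cm _] : [/\ mu v \notin c :: s,
  mu (mu v) = v, e c (mu v) = ~~ e c v & true] by case: L => _ _ _ /(_ v vX)[].
rewrite /loaded_map (negPf vX) (negPf mX) cm; case: (boolP (e c v)) => ev /=.
  by rewrite midK // inE vX.
by rewrite midK // (mid_of L).
Qed.

(** Equal orders force equally many pendant paths. Edges inside the core are read off [M]; all
    others are determined by [mu] and adjacency to the root. *)
Lemma loaded_isomorphic (T T' : finType) (e : rel T) (e' : rel T')
    (c : T) (s : seq T) (mu : T -> T) (c' : T') (s' : seq T') (mu' : T' -> T') M :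
  symmetric e -> symmetric e' -> #|T| = #|T'| ->
  loaded_by e M c s mu -> loaded_by e' M c' s' mu' -> isomorphic e e'.
Proof.
move=> e_sym e'_sym cT L L'.
have cW : #|mids e c s| = #|mids e' c' s'|.
  have := card_loaded L; have := card_loaded L'; rewrite cT -/(mids _ _ _) -/(mids _ _ _).
  lia.
have fK := loaded_mapK L L' cW; have gK := loaded_mapK L' L (esym cW).
exists (loaded_map e e' c s mu c' s' mu'); first by exists (loaded_map e' e c' s' mu' c s mu).
have fc : loaded_map e e' c s mu c' s' mu' c = c' by rewrite /loaded_map mem_head /= eqxx.
have offE x y : x \notin c :: s ->
    e' (loaded_map e e' c s mu c' s' mu' x) (loaded_map e e' c s mu c' s' mu' y) = e x y.
  move=> xX; have [fX fe fm] := loaded_map_off L L' cW xX.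
  case: (L) => _ _ _ /(_ x xX)[_ _ _ ->]; case: (L') => _ _ _ /(_ _ fX)[_ _ _ ->].
  by rewrite -fm (inj_eq (can_inj fK)) -[y == c](inj_eq (can_inj fK)) fc fe.
move=> x y; case: (boolP (x \in c :: s)) => xX; last exact: offE.
case: (boolP (y \in c :: s)) => yX; last by rewrite e'_sym e_sym offE.
have [fX fi] := loaded_map_core L L' xX; have [fY fj] := loaded_map_core L L' yX.
rewrite -(nth_index c' fX) -(nth_index c' fY) fi fj.
rewrite -{2}(nth_index c xX) -{2}(nth_index c yX).
case: L L' => _ sX eX _ [_ _ eX' _].
by rewrite eX' -?eX // -sX index_mem.
Qed.

Lemma loaded_transport (T T' : finType) (e : rel T) (e' : rel T') M c' s' mu' :
  isomorphic e e' -> loaded_by e' M c' s' mu' -> exists c s mu, loaded_by e M c s mu.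
Proof.
case=> f [g fK gK] fe [uX sX eX off].
have eg x y : e (g x) (g y) = e' x y by rewrite -fe !gK.
exists (g c'), (map g s'), (g \o mu' \o f).
rewrite /loaded_by -[g c' :: _]/(map g (c' :: s')).
split=> [||i j ik jk|v].
- by rewrite map_inj_uniq //; exact: (can_inj gK).
- by rewrite size_map.
- by rewrite !(nth_map c') ?sX // eg eX.
have := off (f v); rewrite -(mem_map (can_inj gK)) fK => offv /offv[mX mm cm nv].
split=> [||/=|u /=].
- by rewrite [(_ \o _) v]/= (mem_map (can_inj gK)).
- by rewrite /= gK mm fK.
- by rewrite eg cm -eg fK.
by rewrite -fe nv -!(can2_eq fK gK) -eg fK.
Qed.

(** * The two extremal graphs as loaded graphs *)

Lemma card_loaded_cycle_vertex k p q : #|loaded_cycle_vertex k p q| = k + p + 2 * q.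
Proof. by rewrite !card_sum card_prod !card_ord card_bool mulnC. Qed.

Lemma loaded_cycle_sym k p q (c : 'I_k) : symmetric (@loaded_cycle k p q c).
Proof. by move=> x y; rewrite /loaded_cycle /= orbC. Qed.

Definition loaded_cycle_mu k p q (x : loaded_cycle_vertex k p q) :
    loaded_cycle_vertex k p q :=
  if x is inr (i, b) then inr (i, ~~ b) else x.

Section LoadedCycleOff.
Variables (k p q : nat) (c : 'I_k) (i : 'I_q) (b : bool).
Local Notation E := (@loaded_cycle k p q c).
Local Notation root := (inl (inl c) : loaded_cycle_vertex k p q).
Local Notation v := (inr (i, b) : loaded_cycle_vertex k p q).

Lemma loaded_cycle_root : E root v = ~~ b.
Proof. by rewrite /loaded_cycle /= eqxx orbF. Qed.

Lemma loaded_cycle_off u : E v u = (u == loaded_cycle_mu v) || (u == root) && E root v.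
Proof.
rewrite loaded_cycle_root; case: u => [[j|j]|[j b']] //.
rewrite /loaded_cycle /= orbF -[inr _ == _]/((j, b') == (i, ~~ b)) xpair_eqE (eq_sym i).
by case: (j == i); case: b; case: b'.
Qed.

End LoadedCycleOff.

Lemma U_graph_loaded m : 2 <= m -> exists c s mu,
  loaded_by (U_graph (2 * m) m) (core_mx U_flags [::]) c s mu.
Proof.
move=> m2; have pE : 2 * m + 1 - 2 * m = 1 by lia.
rewrite /U_graph; move: pE; move: (2 * m + 1 - 2 * m) (m - 2) => p q pE; subst p.
have -> : inord 0 = ord0 :> 'I_3 by apply: val_inj; rewrite /= inordK.
pose u i (i3 : i < 3) : loaded_cycle_vertex 3 1 q := inl (inl (Ordinal i3)).
(* Core order: the loaded vertex u1, its pendant vertex, then u2 and u3. *)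
exists (inl (inl ord0)), [:: inl (inr ord0); u 1 isT; u 2 isT], (@loaded_cycle_mu 3 1 q).
split=> //.
- case=> [|[|[|[|i]]]] //; case=> [|[|[|[|j]]]] //; by vm_compute.
case=> [[i|i]|[i b]].
- by case: i => [[|[|[|i]]] ?].
- by rewrite (ord1 i).
move=> _; split=> //=; [by rewrite negbK|by rewrite !loaded_cycle_root|].
exact: loaded_cycle_off.
Qed.

(* Core order: the loaded vertex u2 and its pendant vertex, then u1, u5 and
   u3, u4. *)
Lemma U'_graph_loaded m : 3 <= m -> exists c s mu,
  loaded_by (U'_graph (2 * m) m) (core_mx U'_flags U'_ext) c s mu.
Proof.
move=> m3; have pE : 2 * m + 1 - 2 * m = 1 by lia.
rewrite /U'_graph; move: pE; move: (2 * m + 1 - 2 * m) (m - 3) => p q pE; subst p.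
have -> : inord 1 = Ordinal (isT : 1 < 5) :> 'I_5 by apply: val_inj; rewrite /= inordK.
pose u i (i5 : i < 5) : loaded_cycle_vertex 5 1 q := inl (inl (Ordinal i5)).
pose mu (x : loaded_cycle_vertex 5 1 q) := loaded_cycle_mu x.
exists (u 1 isT), [:: inl (inr ord0); u 0 isT; u 4 isT; u 2 isT; u 3 isT], mu.
split=> //.
- case=> [|[|[|[|[|[|i]]]]]] //; case=> [|[|[|[|[|[|j]]]]]] //; by vm_compute.
case=> [[i|i]|[i b]].
- by case: i => [[|[|[|[|[|i]]]]] ?].
- by rewrite (ord1 i).
move=> _; split=> //=; [by rewrite negbK|by rewrite !loaded_cycle_root|].
exact: loaded_cycle_off.
Qed.

(** * All eccentricities at least 3 *)

Section LargeEccentricity.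
Variables (T : finType) (e : rel T) (m : nat) (mu : T -> T).
Hypotheses (e_sym : symmetric e) (e_irr : irreflexive e).
Hypothesis e_conn : connected_graph e.
Hypotheses (mu_inv : involutive mu) (e_mu : forall v, e v (mu v)).
Hypotheses (card_T : #|T| = 2 * m) (sum_deg_T : \sum_v deg e v = 4 * m).
Hypothesis ecc_ge3 : forall v, 3 <= ecc e v.
Local Notation d := (dist e).
Local Notation deg := (deg e).
Let muN := mu_neq e_irr e_mu.

Lemma deg_gt0 v : 0 < deg v.
Proof. by apply/card_gt0P; exists (mu v); rewrite inE. Qed.

(** A larger degree leaves no free arc, and then the eccentricity of [v] is at most 2. *)
Lemma deg_le v : deg v <= m.
Proof.
rewrite leqNgt; apply/negP => big.
have d2 := big_deg_dist e_sym e_irr e_conn mu_inv e_mu card_T sum_deg_T big.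
have [u du] := ecc_attained e v; have := ecc_ge3 v.
by rewrite -du (dist_sym e_sym e_conn) ltnNge d2.
Qed.

Definition nbr_deg_sum (v : T) : nat := \sum_(x | e v x) deg x.
Local Notation g v := (deg v + nbr_deg_sum v).

Lemma sum_nbr_deg_sum : \sum_v nbr_deg_sum v = \sum_v deg v ^ 2.
Proof.
rewrite /nbr_deg_sum; under eq_bigr do rewrite big_mkcond /=.
rewrite exchange_big /=; apply: eq_bigr => x _.
rewrite -mulnn [X in _ = _ * X]degE big_distrr; apply: eq_bigr => v _ /=.
by rewrite e_sym; case: (e x v); rewrite ?muln1 ?muln0.
Qed.

Lemma card_T1 (v : T) : \sum_(u | u != v) 1 = 2 * m - 1.
Proof. by rewrite sum1_card card_neq card_T subn1. Qed.

(* Vertices at distance 1 lose 2 and those at distance 2 lose 1 against the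
   bound 3; the latter are at most the sum of deg x - 1 over the neighbours x. *)
Lemma distsum_lower v : 6 * m - 3 <= distsum e v + g v.
Proof.
pose F u := d v u + 2 * e v u + \sum_(x | e v x) e x u.
have FE : \sum_u F u = distsum e v + 2 * deg v + nbr_deg_sum v.
  rewrite !big_split /= -(distsum_sym e_sym e_conn) big1_eq addn0 -!degE addnn -mul2n.
  by rewrite exchange_big /=; congr (_ + _); apply: eq_bigr => x _; rewrite degE.
have Fv : F v = deg v.
  rewrite /F distxx e_irr degE big_mkcond; apply: eq_bigr => x _.
  by rewrite [e x v]e_sym; case: (e v x).
have F3 u : u != v -> 3 <= F u.
  rewrite /F eq_sym => vu; case: (boolP (e v u)) => evu.
    by move: vu; rewrite -(dist_gt0 e_conn) /=; lia.
  case: (pickP (fun x => e v x && e x u)) => [x /andP[evx exu]|none].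
    have := dist_ge2 e_irr e_conn vu evu; rewrite (bigD1 x) //= exu.
    move: (\sum_(i | _) _) => S; lia.
  have : 3 <= d v u; last by lia.
  apply: dist_ge3 => // x evx; apply/negP => exu.
  by have := none x; rewrite evx exu.
have : \sum_(u | u != v) 3 <= \sum_(u | u != v) F u by apply: leq_sum.
have := FE; rewrite (bigD1 v) //= Fv.
have -> : \sum_(u | u != v) 3 = 3 * (2 * m - 1) by rewrite -(card_T1 v) big_distrr.
move: (\sum_(u | _) _) => S; lia.
Qed.

Lemma distsum_lower2 v : 4 * m - 2 <= distsum e v + deg v.
Proof.
have F2 u : u != v -> 2 <= d v u + e v u.
  rewrite eq_sym => vu; case: (boolP (e v u)) => evu.
    by move: vu; rewrite -(dist_gt0 e_conn) /=; lia.
  have := dist_ge2 e_irr e_conn vu evu; lia.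
have : \sum_(u | u != v) 2 <= \sum_(u | u != v) (d v u + e v u) by apply: leq_sum.
have -> : \sum_(u | u != v) 2 = 2 * (2 * m - 1) by rewrite -(card_T1 v) big_distrr.
have : \sum_u (d v u + e v u) = distsum e v + deg v.
  by rewrite big_split /= -(distsum_sym e_sym e_conn) -degE.
rewrite (bigD1 v) //= distxx e_irr; lia.
Qed.

Definition leaves : {set T} := [set v | deg v == 1].

Lemma leaf_nbr v x : v \in leaves -> e v x -> x = mu v.
Proof.
rewrite inE => /cards1P[y E] evx.
have in_y u : e v u -> u = y by move=> evu; apply/set1P; rewrite -E inE.
by rewrite (in_y x) // (in_y (mu v)).
Qed.

Lemma dist_leaves z u : z \in leaves -> u != z -> d u z = (d u (mu z)).+1.
Proof. by move=> zL; apply: dist_leaf => // x; exact: leaf_nbr. Qed.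

(** A vertex farthest from [mu z] is at distance at least 3 from it, so it differs from [z] and is
    one step farther from [z]. *)
Lemma ecc_leaf z : z \in leaves -> (ecc e (mu z)).+1 <= ecc e z.
Proof.
move=> zL; have [u du] := ecc_attained e (mu z).
rewrite -du -dist_leaves ?dist_le_ecc //.
apply: contraTneq (ecc_ge3 (mu z)) => uz; rewrite -du uz.
by have /eqP-> : d z (mu z) == 1 by rewrite dist_eq1.
Qed.

Lemma ecc_leaf_ge4 z : z \in leaves -> 4 <= ecc e z.
Proof. by move/ecc_leaf; have := ecc_ge3 (mu z); lia. Qed.

Lemma distsum_leaf_lower z : z \in leaves -> 5 * m - 4 <= distsum e z.
Proof.
move=> zL; have : distsum e z + 2 = distsum e (mu z) + #|T|.
  by apply: distsum_leaf; rewrite 1?eq_sym // => x; exact: leaf_nbr.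
by rewrite card_T; have := distsum_lower2 (mu z); have := deg_le (mu z); lia.
Qed.

Definition centre : {set T} := [set v | ecc e v == 3].

Lemma centre_dist s v : s \in centre -> d s v <= 3.
Proof. by rewrite inE (dist_sym e_sym e_conn) => /eqP <-; exact: dist_le_ecc. Qed.

Lemma centre_nonleaf s : s \in centre -> s \notin leaves.
Proof.
by rewrite inE => /eqP s3; apply/negP => /ecc_leaf_ge4; rewrite s3.
Qed.

Lemma deg_nonleaf v : v \notin leaves -> 2 <= deg v.
Proof. by rewrite inE; have := deg_gt0 v; lia. Qed.

Lemma nbr_deg_sum_ge v : deg v <= nbr_deg_sum v.
Proof.
rewrite degE /nbr_deg_sum [leqRHS]big_mkcond; apply: leq_sum => x _.
by case: (e v x); rewrite ?deg_gt0.
Qed.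

(** These leaves have eccentricity at least 5, and all but at most [#|centre|] leaves are of this
    kind. *)
Definition far_leaves : {set T} := [set v in leaves | mu v \notin centre].

Lemma card_far_leaves : #|leaves| <= #|far_leaves| + #|centre|.
Proof.
have : leaves \subset far_leaves :|: (mu @: centre).
  apply/subsetP => z zL; rewrite in_setU [z \in far_leaves]inE zL /=.
  case: (boolP (mu z \in centre)) => //= mC.
  by apply/imsetP; exists (mu z); rewrite ?mu_inv.
move/subset_leq_card => h; apply: leq_trans h _; apply: leq_trans (leq_card_setU _ _) _.
by rewrite leq_add2l leq_imset_card.
Qed.

(** Pointwise, [distsum_lower] is taken with factor 4. On [centre] this overshoots by one copy of
    [6 * m - 3 - g v]; a far leaf gains a fifth copy of its distance sum, at least [5 * m - 4]. *)
Lemma eds_lower :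
  m * 2 * ((6 * m - 3) * 4) + #|far_leaves| * (5 * m - 4) <=
  ecc_dist_sum e + (4 * m + \sum_v deg v ^ 2) * 4 +
  \sum_(v in centre) (6 * m - 3 - g v).
Proof.
have pt v : (6 * m - 3) * 4 + (v \in far_leaves) * (5 * m - 4) <=
    ecc e v * distsum e v + g v * 4 + (v \in centre) * (6 * m - 3 - g v).
  have D := distsum_lower v; case: (boolP (v \in far_leaves)) => [|_].
    rewrite inE => /andP[vL mC]; have D' := distsum_leaf_lower vL.
    have : 5 <= ecc e v.
      by have := ecc_leaf vL; move: mC; have := ecc_ge3 (mu v); rewrite inE; lia.
    rewrite -(leq_pmul2r (_ : 0 < distsum e v)); first by nia.
    have := ecc_leaf_ge4 vL; have := deg_gt0 v; have := deg_le v; nia.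
  case: (boolP (v \in centre)) => [|vC].
    rewrite inE => /eqP ->; move: (g v) (distsum e v) D => G D'; lia.
  have : 4 <= ecc e v by move: vC; rewrite inE; have := ecc_ge3 v; lia.
  move: (g v) (distsum e v) D => G D'; nia.
have : \sum_v ((6 * m - 3) * 4 + (v \in far_leaves) * (5 * m - 4)) <=
  \sum_v (ecc e v * distsum e v + g v * 4 + (v \in centre) * (6 * m - 3 - g v)).
  by apply: leq_sum => v _.
rewrite !big_split -!big_distrl -cardE_sum big_split sum_deg_T sum_nbr_deg_sum.
rewrite sum_nat_const -/(ecc_dist_sum e).
have -> : #|xpredT : pred T| = m * 2 by rewrite mulnC -card_T.
suff -> : \sum_(v in centre) (6 * m - 3 - g v) =
    \sum_v (v \in centre) * (6 * m - 3 - g v) by rewrite mulnA.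
rewrite big_mkcond; apply: eq_bigr => v _.
by case: (v \in centre); rewrite ?mul1n ?mul0n.
Qed.

(** A degree k with 2 <= k <= m satisfies (k - 2) (k - m) <= 0; for a leaf this product is m - 1. *)
Lemma sum_deg_sq : \sum_v deg v ^ 2 <= 8 * m + #|leaves| * (m - 1).
Proof.
have pt v : deg v ^ 2 + m * 2 <= (m + 2) * deg v + (v \in leaves) * (m - 1).
  have := deg_gt0 v; have := deg_le v; rewrite inE.
  move: (deg v) => k; case: eqP => [->|]; nia.
have : \sum_v (deg v ^ 2 + m * 2) <= \sum_v ((m + 2) * deg v + (v \in leaves) * (m - 1)).
  by apply: leq_sum => v _.
rewrite !big_split -!big_distrl -big_distrr sum_deg_T -cardE_sum sum_nat_const.
have -> : #|xpredT : pred T| = m * 2 by rewrite mulnC -card_T.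
rewrite /=; move: (\sum_v _) => Q; nia.
Qed.

Hypothesis m5 : 5 <= m.

Lemma eds_large_centre3 : #|centre| <= 3 -> 43 * m ^ 2 < ecc_dist_sum e + 72 * m + 4.
Proof.
move=> k3; have := eds_lower; have := sum_deg_sq; have := card_far_leaves.
have : \sum_(v in centre) (6 * m - 3 - g v) <= #|centre| * (6 * m - 7).
  rewrite -sum_nat_const; apply: leq_sum => v /centre_nonleaf /deg_nonleaf dv.
  by have := nbr_deg_sum_ge v; lia.
move: (\sum_(v in centre) _) (\sum_v _) #|far_leaves| #|leaves| k3 => X Q F L.
move: #|centre| (ecc_dist_sum e) => k xi k3 h1 h2 h3 h4.
have kX : k * (6 * m - 7) <= 3 * (6 * m - 7) by rewrite leq_mul2r k3 orbT.
have LF : L * (m - 1) <= (F + 3) * (m - 1) by rewrite leq_mul2r; lia.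
(* A far leaf gains [5 * m - 4] and costs [4 * (m - 1)]. The margin is at least 5 m^2 - 30 m + 37 =
   5 r^2 + 20 r + 12. *)
have [r mr] : exists r, m = r + 5 by exists (m - 5); lia.
by rewrite mr in h1 h2 h3 h4 kX LF *; lia.
Qed.

(** If [h] occurred on [p], at most two edges would remain from [h] to [v]. *)
Lemma path_avoiding (h u v : T) (p : seq T) :
  2 < d h v -> path e u p -> last u p = v -> size p <= 3 -> h \notin p.
Proof.
move=> hv ep lp sp; apply/negP => hp; case/splitPr: hp ep lp sp => p1 p2.
rewrite cat_path last_cat size_cat /= => /and3P[_ _ ep2] lp sp.
by have := dist_le_size ep2; rewrite lp; lia.
Qed.

(* Three central neighbours of h would all reach, avoiding h, a vertex at
   distance 3 from h, so that two of their edges to h could be removed. *)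
Lemma central_nbrs (h : T) : #|[set u in centre | e h u]| <= 2.
Proof.
rewrite leqNgt; apply/negP => /card_gt2P[u1 [u2 [u3 [[]]]]].
rewrite ![_ \in [set u in centre | _]]inE.
move=> /andP[c1 h1] /andP[c2 h2] /andP[c3 h3] [n12 n23 n31].
have [v dv] := ecc_attained e h; have hv : 2 < d h v.
  by rewrite (dist_sym e_sym e_conn) dv.
pose cut x y := (x == h) && ((y == u1) || (y == u2)).
pose e' x y := [&& e x y, ~~ cut x y & ~~ cut y x].
have e'_sym : symmetric e' by move=> x y; rewrite /e' e_sym; case: (cut x y); case: (cut y x).
have uh u : e h u -> u != h by apply: contraTneq => ->; rewrite e_irr.
have reach u : u \in centre -> u != h -> connect e' u v.
  move=> uC nuh; have [p [sp ep lp]] := dist_walk e_conn u v.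
  apply/connectP; exists p => //.
  have hp : h \notin p.
    by apply: (path_avoiding hv ep lp); rewrite sp centre_dist.
  apply: (@sub_in_path _ (predC1 h) e) ep => [x y|].
    by rewrite !inE /e' /cut => /negPf -> /negPf -> ->.
  rewrite /= nuh; apply/allP => x xp /=.
  by apply: contraNneq hp => <-.
have csym := sym_connect_sym e'_sym.
have hv' : connect e' h v.
  have e3 : e' h u3.
    by rewrite /e' h3 /cut eqxx (negPf (uh _ h3)) /= (negPf n31) eq_sym (negPf n23).
  by apply: (@connect_trans _ e' u3); [exact: connect1|apply: reach; rewrite ?uh].
have hu u : u \in centre -> u != h -> connect e' h u.
  by move=> uC nuh; apply: (connect_trans hv'); rewrite csym reach.
have e'_conn : connected_graph e'.
  move=> x y; apply: (connect_sub _ (e_conn x y)) => a b eab.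
  have cutE w z : cut w z -> connect e' w z.
    by case/andP => /eqP -> /orP[] /eqP ->; apply: hu; rewrite ?uh.
  case: (boolP (cut a b)) => [/cutE//|nab].
  case: (boolP (cut b a)) => [/cutE|nba]; first by rewrite csym.
  by apply: connect1; rewrite /e' eab nab.
(* Connectedness requires [4 * m - 2] arcs, but deleting the four arcs of [K] leaves only
   [4 * m - 4]. *)
have := connected_sum_deg e'_sym e'_conn; rewrite card_T -card_arcs.
pose K := [set a in [:: (h, u1); (h, u2); (u1, h); (u2, h)]].
have cK : #|K| = 4.
  rewrite cardsE (card_uniqP _) //= !inE !xpair_eqE !eqxx /= !andbT.
  by rewrite (negPf n12) (eq_sym h) (negPf (uh _ h1)) (eq_sym h) (negPf (uh _ h2)) /= ?andbF.
have dis : [disjoint [set a : T * T | e' a.1 a.2] & K].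
  apply/pred0P => -[x y] /=; apply/negP => /andP[]; rewrite !in_set /e' /cut /= => /and3P[_].
  rewrite !inE !xpair_eqE => n1 n2.
  by case/or4P => /andP[/eqP E1 /eqP E2]; move: n1 n2; rewrite E1 E2 !eqxx ?orbT.
have : [set a : T * T | e' a.1 a.2] :|: K \subset [set a : T * T | e a.1 a.2].
  apply/subsetP => -[x y]; rewrite in_setU => /orP[]; rewrite !in_set.
    by case/and3P.
  by rewrite !inE !xpair_eqE => /or4P[] /andP[/eqP -> /eqP ->] /=; rewrite // e_sym.
move/subset_leq_card; rewrite cardsU (disjoint_setI0 dis) cards0 cK (card_arcs e) sum_deg_T.
by move: (#|[set _ | _]|) => N; clear; lia.
Qed.

(** A central vertex is within 3 of the tip [z], hence within 1 of the attachment vertex [h], and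
    [central_nbrs] applies. *)
Lemma pendant_path_centre z : z \in leaves -> deg (mu z) = 2 -> #|centre| <= 3.
Proof.
move=> zL dw; set w := mu z in dw *.
have ewz : e w z by rewrite e_sym e_mu.
have zw : z != w by rewrite eq_sym muN.
have [h hz [ewh nw]] : exists2 h, h != z & e w h /\ forall x, e w x -> x = z \/ x = h.
  have : #|[set u | e w u] :\ z| = 1.
    by have := cardsD1 z [set u | e w u]; rewrite inE ewz -/(deg w) dw => -[].
  case/eqP/cards1P => h E; have := set11 h; rewrite -E !inE => /andP[hz ewh].
  exists h => //; split=> // x ewx; case: (eqVneq x z) => [->|xz]; [by left|right].
  by apply/set1P; rewrite -E !inE xz.
have far s : s != z -> s != w -> d s w = (d s h).+1.
  by move=> sz sw; apply: (dist_pendant_path e_sym e_conn _ nw) => // x; exact: leaf_nbr.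
have sub : centre \subset h |: [set u in centre | e h u].
  apply/subsetP => s sC; have sz : s != z.
    by apply: contraTneq sC => ->; apply: contraTN zL; exact: centre_nonleaf.
  have sw : s != w.
    (* The middle vertex [w] is not central: a vertex at distance 3 or more from [h] is one step
       farther from [w]. *)
    apply/eqP => sw; have [u du] := ecc_attained e h.
    have := centre_dist u sC; rewrite sw (dist_sym e_sym e_conn).
    have := ecc_ge3 h; rewrite -du.
    have d1 x y : e x y -> d x y = 1 by move=> exy; apply/eqP; rewrite dist_eq1.
    case: (eqVneq u z) => [->|uz].
      have /leq_trans := dist_edge_le e_conn z ewh; rewrite (d1 z w) ?e_mu //.
      by rewrite leqNgt => /(_ _ (leqnn _)); lia.
    case: (eqVneq u w) => [->|uw]; first by rewrite (d1 w h).
    by rewrite far //; lia.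
  have := centre_dist z sC; rewrite dist_leaves // far // !ltnS.
  rewrite in_setU1 inE sC /= leq_eqVlt ltnS leqn0 dist_eq0 //.
  by case/orP; [rewrite dist_eq1 // e_sym => ->; rewrite orbT|move=> ->].
apply: leq_trans (subset_leq_card sub) _.
by rewrite cardsU1; have := central_nbrs h; case: (_ \notin _) => /=; lia.
Qed.

Lemma leaf_support z : z \in leaves -> mu z \notin leaves.
Proof.
move=> zL; apply/negP => mL; have [u du] := ecc_attained e z.
have := ecc_ge3 z; rewrite -du; have [->|uz] := eqVneq u z; first by rewrite distxx.
have [->|um] := eqVneq u (mu z).
  by rewrite (eqP (_ : d (mu z) z == 1)) // dist_eq1 // e_sym.
by have := dist_leaves zL uz; have := dist_leaves mL um; rewrite mu_inv; lia.
Qed.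

Definition core_deg (v : T) : nat := \sum_(u | e v u) (u \notin leaves).

(** A leaf adjacent to [v] is matched to [v], so [mu v] is the only possible one. *)
Lemma deg_core v : deg v = core_deg v + (mu v \in leaves).
Proof.
rewrite degE /core_deg [X in _ = X + _]big_mkcond [RHS]addnC (bigD1 (mu v)) //=.
rewrite [in RHS](bigD1 (mu v)) //= e_mu.
rewrite addnA; congr (_ + _); first by case: (mu v \in leaves).
apply: eq_bigr => u um; case: (boolP (e v u)) => // evu.
by case: (boolP (u \in leaves)) => // /leaf_nbr nu; rewrite (nu v) ?mu_inv ?eqxx // e_sym in um.
Qed.

(** * No pendant path of length 2: the core is a cycle *)

Section NoPendantPath.
Hypothesis no_pendant : forall z, z \in leaves -> deg (mu z) <> 2.
Local Notation C := (~: leaves).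

Lemma card_core : #|C| + #|leaves| = 2 * m.
Proof. by rewrite addnC cardsC card_T. Qed.

Lemma core_deg_ge v : v \in C -> 2 <= core_deg v.
Proof.
rewrite inE => vC; have := deg_nonleaf vC; rewrite deg_core.
case: (boolP (mu v \in leaves)) => [mL|_]; last by rewrite addn0.
by have := no_pendant mL; rewrite mu_inv deg_core mL /=; lia.
Qed.

Lemma sum_supports : \sum_(v in C) (mu v \in leaves) = #|leaves|.
Proof.
rewrite big_mkcond [RHS]cardE_sum [RHS](reindex_inj (inv_inj mu_inv)) /=.
apply: eq_bigr => v _; rewrite inE.
by case: (boolP (v \in leaves)) => //= vL; rewrite (negPf (leaf_support vL)).
Qed.

(** The core degrees add up to [4 * m - 2 * #|leaves|], that is [2 * #|C|], and none is below 2. *)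
Lemma core_deg2 v : v \in C -> core_deg v = 2.
Proof.
move=> vC; apply/eqP; rewrite eqn_leq core_deg_ge // andbT leqNgt; apply/negP => v3.
have tot : \sum_(v in C) core_deg v = 2 * #|C|.
  have := sum_deg_T; rewrite (bigID (mem leaves)) /=.
  rewrite (eq_bigr (fun=> 1)) => [|u]; last by rewrite inE => /eqP.
  rewrite sum1_card (eq_bigl (fun u => u \in C)) => [|u]; last by rewrite in_setC.
  under [X in _ + X]eq_bigr do rewrite deg_core.
  by rewrite big_split /= sum_supports; have := card_core; lia.
have le : \sum_(u in C | u != v) 2 <= \sum_(u in C | u != v) core_deg u.
  by apply: leq_sum => u /andP[uC _]; exact: core_deg_ge.
have : \sum_(u in C) core_deg u = \sum_(u in C) 2 by rewrite tot sum_nat_const [RHS]mulnC.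
rewrite (bigD1 v) //= [RHS](bigD1 v) //= => E.
by move: v3; rewrite ltnNge -(leq_add2r (\sum_(u in C | u != v) core_deg u)) E leq_add2l le.
Qed.

Definition level (s : T) (i : nat) : {set T} := [set v in C | d s v == i].

Lemma core_pred s x i : s \in C -> d s x = i.+1 ->
  exists w, [/\ w \in C, d s w = i & e w x].
Proof.
move=> sC dx; have [w dw ewx] := dist_pred e_conn dx; exists w; split=> //.
rewrite inE; apply/negP => wL.
have sw : s != w by apply: contraTneq sC => ->; rewrite inE wL.
by have := dist_leaves wL sw; rewrite -(leaf_nbr wL ewx) dw dx; lia.
Qed.

Lemma card_level1 s : s \in C -> #|level s 1| = 2.
Proof.
move=> sC; rewrite -(core_deg2 sC) /core_deg cardE_sum [RHS]big_mkcond.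
by apply: eq_bigr => u _; rewrite !inE dist_eq1 // andbC; case: (e s u); case: (deg u == 1).
Qed.

(** One of the two core neighbours of a vertex lies a level below, so at most one lies a level
    above. *)
Lemma card_levelS s i : s \in C -> #|level s i.+2| <= #|level s i.+1|.
Proof.
move=> sC.
apply: (@leq_trans (\sum_(y in level s i.+2) \sum_(x in level s i.+1) e x y)).
  rewrite -sum1_card; apply: leq_sum => y; rewrite inE => /andP[_ /eqP dy].
  have [w [wC dw ewy]] := core_pred sC dy.
  by rewrite (bigD1 w) /= ?ewy // inE wC dw eqxx.
rewrite exchange_big /= -[leqRHS]sum1_card; apply: leq_sum => x.
rewrite inE => /andP[xC /eqP dx]; have [w [wC dw ewx]] := core_pred sC dx.
have := core_deg2 xC; rewrite /core_deg (bigD1 w) /=; last by rewrite e_sym.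
move: (wC); rewrite inE => -> /= [] E; rewrite -E.
rewrite big_mkcond [leqRHS]big_mkcond; apply: leq_sum => y _.
rewrite [y \in level _ _]inE in_setC.
case: (boolP (d s y == i.+2)) => [/eqP dy|_]; last by rewrite andbF.
have yw : y != w by apply/eqP => yw; move: dy; rewrite yw dw; clear; lia.
by rewrite yw !andbT; case: (e x y); case: (y \in leaves).
Qed.

Lemma card_level_le s i : s \in C -> #|level s i.+1| <= 2.
Proof.
move=> sC; elim: i => [|i IH]; first by rewrite card_level1.
exact: leq_trans (card_levelS i sC) IH.
Qed.

Definition supports : {set T} := [set v in C | mu v \in leaves].

Lemma card_supports : #|supports| = #|leaves|.
Proof.
rewrite -sum_supports cardE_sum [RHS]big_mkcond; apply: eq_bigr => v _.
by rewrite [v \in supports]inE; case: (v \in C); case: (mu v \in leaves).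
Qed.

Lemma centre_core s : s \in centre -> s \in C.
Proof. by move=> sS; rewrite in_setC; exact: centre_nonleaf. Qed.

Lemma support_level s v : s \in centre -> v \in supports -> d s v <= 2.
Proof.
move=> sS; rewrite inE => /andP[_ mL].
have sm : s != mu v by apply: contraTneq mL => <-; exact: centre_nonleaf.
by have := centre_dist (mu v) sS; rewrite dist_leaves // mu_inv.
Qed.

Lemma card_level0 s : s \in C -> #|level s 0| = 1.
Proof.
move=> sC; rewrite (_ : level s 0 = [set s]) ?cards1 //.
apply/setP => v; rewrite in_set1 inE dist_eq0 // eq_sym.
by case: eqVneq => [->|_]; rewrite ?sC ?andbF.
Qed.

(** Levels 0 to 3 exhaust the core, the first two having 1 and 2 vertices. Supports stay within
    level 2 because their leaves are within distance 3. *)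
Lemma core_levels s : s \in centre -> [/\ #|C| = 3 + #|level s 2| + #|level s 3|,
  #|supports| <= 3 + #|level s 2| & #|level s 3| <= #|C| - #|supports|].
Proof.
move=> sS; have sC := centre_core sS.
have cC (A : {set T}) : A \subset C -> #|A| = #|A :&: level s 0| + #|A :&: level s 1| +
    #|A :&: level s 2| + #|A :&: level s 3|.
  move=> /subsetP AC; rewrite !cardE_sum -!big_split /=; apply: eq_bigr => v _.
  rewrite !in_setI; case: (boolP (v \in A)) => //= vA.
  rewrite ![v \in level s _]inE (AC v vA) /=; have := centre_dist v sS.
  by case: (d s v) => [|[|[|[|j]]]].
have lC i : C :&: level s i = level s i.
  by apply/setIidPr/subsetP => v; rewrite inE => /andP[].
have CE := cC C (subxx _); rewrite !lC card_level0 // card_level1 // in CE.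
have sub : supports \subset C by apply/subsetP => v; rewrite inE => /andP[].
have := cC supports sub.
have -> : supports :&: level s 3 = set0.
  apply/setP => v; rewrite inE [v \in level s 3]inE [RHS]inE.
  by apply/negP => /and3P[/(support_level sS) h _ /eqP E]; rewrite E in h.
rewrite cards0 addn0 => SE.
have le i : #|supports :&: level s i| <= #|level s i| by rewrite subset_leq_card ?subsetIr.
have := le 0; have := le 1; have := le 2; rewrite card_level0 // card_level1 //.
move: #|C| CE #|supports| SE => a CE b SE h2 h1 h0.
by split; move: SE CE h0 h1 h2; clear; lia.
Qed.

(** Double counting of pairs at distance 3 between a central vertex and a core vertex without leaf;
    the latter has at most two core vertices at distance 3. *)
Lemma centre_level3 n : (forall s, s \in centre -> n <= #|level s 3|) ->
  #|centre| * n <= 2 * (#|C| - #|supports|).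
Proof.
move=> le3; rewrite -sum_nat_const.
apply: (@leq_trans (\sum_(s in centre) \sum_(t in C :\: supports) (d s t == 3))).
  apply: leq_sum => s sS; apply: leq_trans (le3 s sS) _.
  rewrite cardE_sum [leqRHS]big_mkcond; apply: leq_sum => t _.
  rewrite in_setD [t \in level s 3]inE.
  case: (boolP (t \in supports)) => [/(support_level sS)|_].
    by move=> h; case: eqP h => [->|]; rewrite ?andbF.
  by case: (t \in C).
rewrite exchange_big /=.
have -> : 2 * (#|C| - #|supports|) = \sum_(t in C :\: supports) 2.
  rewrite sum_nat_const [RHS]mulnC cardsD; congr (_ * (_ - _)); apply: eq_card => v.
  by rewrite !inE; case: (deg v == 1).
apply: leq_sum => t; rewrite inE => /andP[_ tC].
apply: leq_trans (card_level_le 2 tC); rewrite cardE_sum big_mkcond.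
apply: leq_sum => s _; case: (boolP (s \in centre)) => // /centre_core sC.
by rewrite [s \in level t 3]inE sC (dist_sym e_sym e_conn t).
Qed.

(** The degrees are 1 at leaves, 3 at supports and 2 elsewhere; 9 is written 4 + 5. *)
Lemma sum_deg_sq_core : \sum_v deg v ^ 2 = 8 * m + 2 * #|leaves|.
Proof.
have pt v : deg v ^ 2 = (v \in leaves) + (v \in C) * 4 + (v \in supports) * 5.
  rewrite [v \in supports]inE; case: (boolP (v \in leaves)) => vL.
    rewrite [v \in C]inE vL; move: vL; rewrite inE => /eqP ->; by [].
  have vC : v \in C by rewrite inE.
  by rewrite vC deg_core core_deg2 //; case: (mu v \in leaves).
rewrite (eq_bigr _ (fun v _ => pt v)) !big_split -!big_distrl /= -!cardE_sum card_supports.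
have := card_core; lia.
Qed.

Lemma eds_large_no_pendant : 43 * m ^ 2 < ecc_dist_sum e + 72 * m + 4.
Proof.
case: (leqP #|centre| 3) => [|k4]; first exact: eds_large_centre3.
have [s sS] : exists s, s \in centre by apply/card_gt0P; lia.
have sC := centre_core sS.
have [CE SL L3] := core_levels sS.
have l2 := card_level_le 1 sC; have l32 := card_levelS 1 sC.
have CL := card_core; have SE := card_supports.
have le3 t : t \in centre -> #|C| - 5 <= #|level t 3|.
  move=> tS; have [h _ _] := core_levels tS.
  by have := card_level_le 1 (centre_core tS); rewrite h; clear; lia.
have := centre_level3 le3 => k3.
(* At most 7 core vertices and at most 5 supports give [2 * m <= 12]. *)
have [m6|m5'] : m = 6 \/ m = 5 by move: CE SL L3 l2 l32 CL SE m5; clear; lia.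
  (* Here 5 core vertices are supports, and [centre_level3] with [n = 2] allows at most two central
     vertices. *)
  have c7 : #|C| = 7 by move: CE SL L3 l2 l32 CL SE m6; clear; lia.
  by move: k3 k4; rewrite c7; move: CL; rewrite SE c7 m6; clear; lia.
have := eds_lower; rewrite sum_deg_sq_core.
have kC : #|centre| <= #|C|.
  by apply: subset_leq_card; apply/subsetP => t; exact: centre_core.
have gE (t : T) : t \in centre -> 4 <= g t.
  by move=> /centre_nonleaf /deg_nonleaf dt; have := nbr_deg_sum_ge t; lia.
have X4 : \sum_(v in centre) (6 * m - 3 - g v) <= #|centre| * 23.
  rewrite -sum_nat_const; apply: leq_sum => v /gE; rewrite m5'; lia.
(* Each of the five core vertices carries a leaf and has degree 3, so [g v] is at least 3 + (3 + 3 +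
   1) = 10, and 27 - 10 = 17. *)
have X10 : #|C| = 5 -> \sum_(v in centre) (6 * m - 3 - g v) <= #|centre| * 17.
  move=> C5; rewrite -sum_nat_const; apply: leq_sum => v /centre_core vC.
  have SC : supports = C.
    apply/eqP; rewrite eqEcard; apply/andP; split.
      by apply/subsetP => u; rewrite inE => /andP[].
    by rewrite SE; move: CL; rewrite C5 m5'; clear; lia.
  have mL u : u \in C -> (mu u \in leaves) by rewrite -SC inE => /andP[].
  have dC u : u \in C -> deg u = 3 by move=> uC; rewrite deg_core core_deg2 // mL.
  have : \sum_(x | e v x) (1 + (x \notin leaves) * 2) <= nbr_deg_sum v.
    apply: leq_sum => x _; case: (boolP (x \in leaves)) => xL; first by rewrite deg_gt0.
    by rewrite dC ?in_setC.
  rewrite big_split -big_distrl /= -/(core_deg v) core_deg2 //.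
  have -> : \sum_(x | e v x) 1 = deg v.
    by rewrite degE big_mkcond; apply: eq_bigr => x _; case: (e v x).
  rewrite dC // m5'; lia.
have [C5|C67] : #|C| = 5 \/ 5 < #|C| <= 7 by move: CE SL L3 l2 l32 CL SE m5'; clear; lia.
  move: (X10 C5); rewrite -[in X in _ -> X]SE.
  by move: kC CL SE; rewrite C5 m5'; clear; lia.
(* A core of 6 or 7 vertices has 4 or 3 supports; [centre_level3] applies with [n = 1] or
   [n = 2]. *)
have k4' : #|centre| <= 4.
  by move: k3 C67 CL SE; rewrite m5'; clear; nia.
by move: X4 k4' CL C67; rewrite m5'; clear; lia.
Qed.

End NoPendantPath.

Lemma eds_large : 43 * m ^ 2 < ecc_dist_sum e + 72 * m + 4.
Proof.
case: (boolP [exists z in leaves, deg (mu z) == 2]) => [/exists_inP[z zL /eqP dz]|none].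
  exact: eds_large_centre3 (pendant_path_centre zL dz).
apply: eds_large_no_pendant => z zL dz; move/negP: none; apply.
by apply/exists_inP; exists z => //; rewrite dz.
Qed.

End LargeEccentricity.

Theorem theorem3p2 (m : nat) (T : finType) (e : rel T) :
  5 <= m ->
  unicyclic_class e (2 * m) m ->
  ~ isomorphic e (U_graph (2 * m) m) ->
  (43 * m%:Z ^+ 2 - 72 * m%:Z - 4 <= (ecc_dist_sum e)%:Z)%R /\
  (((ecc_dist_sum e)%:Z = 43 * m%:Z ^+ 2 - 72 * m%:Z - 4)%R <->
   isomorphic e (U'_graph (2 * m) m)).
Proof.
move=> m5 [[[e_sym e_irr] e_conn cE] cT mn] notU.
have sum_deg_T : \sum_v deg e v = 4 * m by rewrite sum_deg // -cE cT; lia.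
have [mu [mu_inv e_mu]] := perfect_matching e_sym e_irr cT mn.
have iso_eds : isomorphic e (U'_graph (2 * m) m) -> ecc_dist_sum e + 72 * m + 4 = 43 * m ^ 2.
  move=> iso; have [c' [s' [mu' L']]] := U'_graph_loaded (ltac:(lia) : 3 <= m).
  have [c [s [nu L]]] := loaded_transport iso L'.
  by apply: (U'_like_ecc_dist_sum (mu := nu) (c := c) e_sym e_irr e_conn cT sum_deg_T m5); exists s.
have dichotomy : 43 * m ^ 2 < ecc_dist_sum e + 72 * m + 4 \/ isomorphic e (U'_graph (2 * m) m).
  case: (boolP [forall v, 3 <= ecc e v]) => [/forallP ecc3|].
    by left; exact: (eds_large e_sym e_irr e_conn mu_inv e_mu cT sum_deg_T ecc3 m5).
  rewrite negb_forall => /existsP[c]; rewrite -ltnNge => ecc2.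
  have depth2 v : dist e c v <= 2.
    by rewrite dist_sym //; apply: leq_trans (dist_le_ecc _ _ _) _.
  case: (depth2_classification e_sym e_irr e_conn mu_inv e_mu cT sum_deg_T m5 depth2).
  - case=> s L; case: notU; have [c' [s' [mu' L']]] := U_graph_loaded (ltac:(lia) : 2 <= m).
    apply: loaded_isomorphic L L' => //; first exact: loaded_cycle_sym.
    by rewrite card_loaded_cycle_vertex cT; lia.
  - case=> s L; right; have [c' [s' [mu' L']]] := U'_graph_loaded (ltac:(lia) : 3 <= m).
    apply: loaded_isomorphic L L' => //; first exact: loaded_cycle_sym.
    by rewrite card_loaded_cycle_vertex cT; lia.
  by left.
have eqE : ((ecc_dist_sum e)%:Z = 43 * m%:Z ^+ 2 - 72 * m%:Z - 4)%R <->
    ecc_dist_sum e + 72 * m + 4 = 43 * m ^ 2.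
  split=> h; nia.
split; last first.
  rewrite eqE; split=> // eq_eds; case: dichotomy => //; lia.
by case: dichotomy => [|/iso_eds]; nia.
Qed.
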